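(* There exists a finitely generated group $\Gamma$ of finite twin-width that is not accessible.
   Context: **Cayley graphs.** For a group $\Gamma$ and a finite generating set $S$ of $\Gamma$, the Cayley graph $\mathrm{Cay}(\Gamma;S)$ is the graph with vertex set $\Gamma$ and edges $\{g,gs\}$ for $g\in\Gamma$, $s\in S$ (loops are ignored). **Accessibility.** A ray in a graph is an infinite one-way path. Two rays are equivalent if they are joined by infinitely many pairwise disjoint paths. An end is an equivalence class of rays. A locally finite graph $G$ is accessible if there exists a constant $k\in\mathbb{N}$ such that any two distinct ends of $G$ can be separated by at most $k$ edges. A finitely generated group is accessible if one (equivalently, every) Cayley graph of it with respect to a finite generating set is accessible. **Twin-width.** Twin-width here means strict twin-width; for graphs of bounded degree its finiteness is equivalent to finiteness of ordinary twin-width. A vertex identification on a graph $G$ deletes two distinct vertices $u,v\in V(G)$ and adds a new vertex $w$ with neighbourhood $N(w)=(N(u)\cup N(v))\setminus\{u,v\}$. For a finite graph $G$ on $n$ vertices, consider sequences $G=G_n\to G_{n-1}\to\cdots\to G_1$ in which each graph is obtained from the previous one by a vertex identification, so that $G_i$ has $i$ vertices. The width of such a sequence is $\max\{\Delta(G_n),\dots,\Delta(G_1)\}$, where $\Delta$ denotes maximum degree. The strict twin-width of $G$ is the minimum width over all such sequences. The strict twin-width of an infinite graph is the supremum of the strict twin-widths of its finite induced subgraphs. A finitely generated group has finite twin-width if one (equivalently, every) Cayley graph of it with respect to a finite generating set has finite twin-width. *)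

(* Defs.v *)
From mathcomp Require Import all_boot finmap.
From mathcomp Require Import boolp classical_sets.

Set Implicit Arguments.
Unset Strict Implicit.
Unset Printing Implicit Defensive.

Local Open Scope fset_scope.

Record sgraph (V : Type) := SGraph {
  adj :> rel V;
  adj_sym : symmetric adj;
  adj_irr : irreflexive adj }.

Section Identification.
Variables (V : finType) (G : sgraph V) (u v : V).

(* [None] is the new vertex w. *)
Definition identify_vertex : finType := option {x : V | x \notin [:: u; v]}.

Definition identify_adj : rel identify_vertex := fun a b =>
  match a, b with
  | Some x, Some y => G (val x) (val y)
  | Some x, None | None, Some x => G u (val x) || G v (val x)
  | None, None => false
  end.

Lemma identify_sym : symmetric identify_adj.
Proof. by move=> [x|] [y|] //=; rewrite adj_sym. Qed.

Lemma identify_irr : irreflexive identify_adj.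
Proof. by move=> [x|] //=; rewrite adj_irr. Qed.

Definition identify : sgraph identify_vertex := SGraph identify_sym identify_irr.
End Identification.

Definition max_degree (V : finType) (G : sgraph V) : nat :=
  \max_(x : V) #|G x|.

(* The sequences G = G_n -> ... -> G_1; each identification removes exactly one
   vertex, so the graph reached after n - i steps has i vertices. *)
Inductive identification_seq (V : finType) (G : sgraph V) : Type :=
| IdentDone of #|V| = 1
| IdentStep (u v : V) of u != v & identification_seq (identify G u v).

Fixpoint width (V : finType) (G : sgraph V) (s : identification_seq G) : nat :=
  match s with
  | IdentDone _ => max_degree G
  | IdentStep _ _ _ s' => maxn (max_degree G) (width s')
  end.

(* A minimum exists as soon as V is nonempty; the graph without vertices, which
   has no identification sequence, gets the default value 0. *)
Definition strict_twin_width (V : finType) (G : sgraph V) : nat :=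
  xget 0 [set k | (exists s : identification_seq G, width s = k) /\
                  (forall s : identification_seq G, k <= width s)]%classic.

Section Infinite.
Variables (V : choiceType) (G : sgraph V).

Definition induced_adj (A : {fset V}) : rel A := fun x y => G (val x) (val y).

Lemma induced_sym A : symmetric (@induced_adj A).
Proof. by move=> x y; apply: adj_sym. Qed.

Lemma induced_irr A : irreflexive (@induced_adj A).
Proof. by move=> x; apply: adj_irr. Qed.

Definition induced (A : {fset V}) : sgraph A :=
  SGraph (@induced_sym A) (@induced_irr A).

(* The supremum of the strict twin-widths of the finite induced subgraphs is
   finite. *)
Definition finite_twin_width : Prop :=
  exists d : nat, forall A : {fset V}, strict_twin_width (induced A) <= d.

Record ray := Ray {
  ray_vertex :> nat -> V;
  ray_inj : injective ray_vertex;
  ray_adj : forall n, G (ray_vertex n) (ray_vertex n.+1) }.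

(* [x :: p] is a path in G from a vertex of r to a vertex of r'; it is allowed
   to be a single vertex common to both rays. *)
Definition joining_path (r r' : ray) (x : V) (p : seq V) : Prop :=
  [/\ path G x p, uniq (x :: p), exists i, r i = x & exists j, r' j = last x p].

Definition ray_equiv (r r' : ray) : Prop :=
  exists P : nat -> V * seq V,
    (forall i, joining_path r r' (P i).1 (P i).2) /\
    (forall i j, i != j -> forall z,
       ~ (z \in (P i).1 :: (P i).2 /\ z \in (P j).1 :: (P j).2)).

Definition is_end (w : set ray) : Prop :=
  exists r : ray, w = [set r' | ray_equiv r r']%classic.

Definition edge_set (F : {fset {fset V}}) : Prop :=
  forall f, f \in F -> exists x y, G x y /\ f = [fset x; y].

Definition same_component_minus (F : {fset {fset V}}) (x y : V) : Prop :=
  exists2 p, path (fun a b => G a b && ([fset a; b] \notin F)) x p & last x p = y.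

(* Every ray of w has a tail in the component of x in G - F. *)
Definition end_lives_in (F : {fset {fset V}}) (w : set ray) (x : V) : Prop :=
  forall r : ray, w r ->
    exists N, forall n, N <= n -> same_component_minus F x (r n).

Definition separates (F : {fset {fset V}}) (w w' : set ray) : Prop :=
  exists x y, [/\ end_lives_in F w x, end_lives_in F w' y
                & ~ same_component_minus F x y].

(* Only meant for locally finite graphs, such as the Cayley graphs below. *)
Definition accessible : Prop :=
  exists k : nat, forall w w' : set ray, is_end w -> is_end w' -> w <> w' ->
    exists F : {fset {fset V}}, [/\ edge_set F, #|` F| <= k & separates F w w'].
End Infinite.

Section Groups.
Local Open Scope group_scope.
Variable Gamma : groupType.

Definition generates (S : {fset Gamma}) : Prop :=
  forall g : Gamma, exists2 w : seq Gamma,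
    all (fun x => (x \in S) || (x^-1 \in S)) w & g = \prod_(x <- w) x.

Definition finitely_generated : Prop := exists S : {fset Gamma}, generates S.

Definition cayley_adj (S : {fset Gamma}) : rel Gamma := fun g h =>
  (g != h) && [exists s : S, (h == g * val s) || (g == h * val s)].

Lemma cayley_sym S : symmetric (cayley_adj S).
Proof.
by move=> g h; rewrite /cayley_adj eq_sym; congr andb; apply: eq_existsb => s;
  rewrite orbC.
Qed.

Lemma cayley_irr S : irreflexive (cayley_adj S).
Proof. by move=> g; rewrite /cayley_adj eqxx. Qed.

Definition Cay (S : {fset Gamma}) : sgraph Gamma :=
  SGraph (cayley_sym S) (cayley_irr S).

Definition group_accessible : Prop :=
  exists2 S : {fset Gamma}, generates S & accessible (Cay S).

Definition group_finite_twin_width : Prop :=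
  exists2 S : {fset Gamma}, generates S & finite_twin_width (Cay S).
End Groups.

(* Main.v *)
Require Import Defs.
From mathcomp Require Import all_boot finmap boolp classical_sets zify generic_quotient.
From HB Require Import structures.
From mathcomp Require Import order ssralg ssrnum ssrint.

Set Implicit Arguments.
Unset Strict Implicit.
Unset Printing Implicit Defensive.

(** The lamp configurations are the leaves of a binary tree T, the node of level
  n above f being the class of f modulo the lamps of code < n. Let N be
  generated by involutions z_f, one for each leaf, subject to the relations that
  make the products z_v of the generators below a node v commute for siblings:
  N is the fundamental group of a graph of Klein four-groups over T. Let Gam be
  the free product of Z copies of N, extended by the lamplighter group, which
  permutes the copies and acts on each of them through its lamps.

  Gam is not accessible: removing the edge of the Bass-Serre tree of N stabilised
  by z_v, where v has level n, cuts out a set B that is almost invariant in Gam.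
  It contains the positive powers, and no negative power, of an element t that
  commutes with the group K of all lamps of code < n - 1. The ends of t and t^-1
  cannot be separated by fewer than |K| edges, because the translates by K of a
  shortest path are disjoint.

  Finite twin-width: a finite subgraph is collapsed to a point by a sequence of
  partitions whose quotients have bounded degree and in which every part is a
  union of boundedly many parts of the preceding partition. Each element of Gam is
  placed in the Bass-Serre tree of a coset m N_c; for fixed m these cosets form a
  hub, and the one nearest to the root is its gate. The outermost hubs are treated
  first: in every coset but the gate, the branches leaving the copy of T at m are
  cut back edge by edge, then the lamps invisible from the gate are forgotten one
  code at a time, and finally the copies of T are folded onto that of the gate. *)

(** * Collapsing sequences *)

(** N is not finitely generated; the lamplighter repairs this. In state (i, f) the generator z
    multiplies by z_f in copy i, so one involution, one lamp and one shift generate Gam. The lamps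
    permute the leaves and preserve T, but the shift moves codes and does not. Hence it cannot act
    on N itself, and there is one copy of N for each integer, its tree being read in lamps shifted
    by that integer. A shift by one changes codes by at most 2, so a node of level n of one copy
    determines a node of level n + 2 of the next; this keeps the quotients of a hub bounded. All
    edge groups of N have order two, but the lamps of code < n fix every node of level at least n:
    these growing finite groups force large cuts. Equality in N is agreement in all actions that
    satisfy the relations. An invariant of N (the abelianisation, the wall, the reduced words) is
    therefore obtained by exhibiting one such action, with no normal form. *)

Section Collapse.
Variables (A : finType) (G : sgraph A) (c d : nat).

(** Classes are listed through representatives in [A]: the label types vary along a chain and need
    no equality test. *)
Definition quotient_degree (L : Type) (phi : A -> L) : Prop :=
  forall x, exists ys : seq A, size ys <= d /\
    forall x' y, phi x' = phi x -> G x' y -> exists2 y', y' \in ys & phi y' = phi y.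

Definition bounded_merge (L L' : Type) (phi : A -> L) (psi : A -> L') : Prop :=
  (forall x y, phi x = phi y -> psi x = psi y) /\
  forall x, exists ys : seq A, size ys <= c /\
    forall y, psi y = psi x -> exists2 y', y' \in ys & phi y' = phi y.

Inductive collapsible : forall L : Type, (A -> L) -> Prop :=
| CollapseEnd (L : Type) (phi : A -> L) of (forall x y, phi x = phi y) :
    collapsible phi
| CollapseStep (L L' : Type) (phi : A -> L) (psi : A -> L') of
    quotient_degree phi & bounded_merge phi psi & collapsible psi :
    collapsible phi.

(** It is enough that the edges of [K] come from edges of [G], since degrees are only bounded from
    above; this survives identifications. *)
Definition quotient_graph (V : finType) (K : sgraph V) (q : A -> V) : Prop :=
  (forall v, exists x, q x = v) /\
  forall u v, K u v -> exists x y, [/\ q x = u, q y = v & G x y].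

Lemma quotient_graph_identify (V : finType) (K : sgraph V) (q : A -> V) (u v : V) :
  quotient_graph K q -> u != v ->
  quotient_graph (identify K u v) (fun x => insub (q x)).
Proof.
move=> [sq eK] nuv; split.
  case=> [[y yP]|]; last by have [x xP] := sq u; exists x; rewrite insubN // inE xP eqxx.
  have [x xP] := sq y; exists x; rewrite insubT /= ?xP // => p.
  by congr Some; apply: val_inj.
have NonE (x : A) (y : {x : V | x \notin [:: u; v]}) :
    q x = val y -> insub (q x) = Some y.
  by move=> ->; rewrite valK.
have NoneE (x : A) (w : V) : q x = w -> w \in [:: u; v] ->
    insub (q x) = None :> option {x : V | x \notin [:: u; v]}.
  by move=> -> h; rewrite insubN // h.
have uin : u \in [:: u; v] by rewrite mem_head.
have vin : v \in [:: u; v] by rewrite !inE eqxx orbT.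
case=> [a|] [b|] //=.
- by move=> /eK[x [y [xa yb Gxy]]]; exists x, y; split=> //; exact: NonE.
- by case/orP=> /eK[x [y [xa yb Gxy]]]; exists y, x;
    rewrite (adj_sym G); split; rewrite ?(NonE _ _ yb) //; exact: NoneE xa _.
- by case/orP=> /eK[x [y [xa yb Gxy]]]; exists x, y;
    split; rewrite ?(NonE _ _ yb) //; exact: NoneE xa _.
Qed.

Definition small_width (V : finType) (K : sgraph V) : Prop :=
  exists s : identification_seq K, width s <= c * d.

Lemma card_identify (V : finType) (u v : V) :
  u != v -> #|identify_vertex u v| < #|V|.
Proof.
move=> nuv; rewrite card_option card_sig.
have -> : #|[pred x | x \notin [:: u; v]]| = #|V| - 2.
  have -> : #|[pred x | x \notin [:: u; v]]| = #|[predC [:: u; v]]|.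
    by apply: eq_card => x; rewrite !inE.
  have := cardC (mem [:: u; v]).
  have -> : #|mem [:: u; v]| = 2.
    by have /card_uniqP : uniq [:: u; v] by rewrite /= inE nuv.
  by move=> <-; rewrite addKn; apply: eq_card => x; rewrite !inE.
have : 1 < #|V|.
  have -> : 1 = #|[set u]| by rewrite cards1.
  rewrite -cardsT; apply: proper_card; rewrite properE finset.subsetT /=.
  by apply/fintype.subsetPn; exists v; rewrite ?inE // eq_sym.
by case: #|V| => [|[|n]] //= _; rewrite subn2 /=.
Qed.

(** Pairs inside a class of [psi] are identified one at a time. An intermediate class lies in one
    class of [psi], so it is made of at most [c] classes of [phi], each with at most [d]
    neighbouring classes: hence the product [c * d]. *)
Lemma small_width_step (L L' : Type) (phi : A -> L) (psi : A -> L') :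
  quotient_degree phi -> bounded_merge phi psi ->
  (forall (V : finType) (K : sgraph V) (q : A -> V), quotient_graph K q ->
     (forall x y, q x = q y <-> psi x = psi y) -> small_width K) ->
  forall (V : finType) (K : sgraph V) (q : A -> V), quotient_graph K q ->
    (forall x y, phi x = phi y -> q x = q y) ->
    (forall x y, q x = q y -> psi x = psi y) -> small_width K.
Proof.
move=> dphi [le_phi merge] IH V; move: {2}#|V| (leqnn #|V|) => n.
elim: n V => [|n IHn] V leV K q qG phiq qpsi.
  apply: IH qG _ => x; have /card0_eq/(_ (q x)) : #|V| = 0 by apply/eqP; rewrite -leqn0.
  by rewrite inE.
have [same|] := pselect (forall x y, psi x = psi y -> q x = q y).
  by apply: IH qG _ => x y; split; [exact: qpsi|exact: same].
move=> /existsNP[x /existsNP[y /not_implyP[exy /eqP nq]]].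
have degK : max_degree K <= c * d.
  apply/bigmax_leqP => w _; have [x0 x0w] := qG.1 w.
  have [ys [sz_ys ysP]] := merge x0.
  pose nbr (y0 : A) := xget [::]%SEQ [set s : seq A | size s <= d /\ forall x' z,
    phi x' = phi y0 -> G x' z -> exists2 y', y' \in s & phi y' = phi z]%classic.
  have nbrP y0 : size (nbr y0) <= d /\ forall x' z, phi x' = phi y0 -> G x' z ->
      exists2 y', y' \in nbr y0 & phi y' = phi z.
    have [s sP] := dphi y0.
    by have := @xgetPex _ [::] [set s : seq A | size s <= d /\ forall x' z,
      phi x' = phi y0 -> G x' z -> exists2 y', y' \in s & phi y' = phi z]%classic
      (ex_intro _ s sP).
  pose nb := flatten [seq nbr y0 | y0 <- ys].
  have sz_nb : size nb <= c * d.
    apply: leq_trans (leq_mul sz_ys (leqnn d)).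
    rewrite /nb; elim: ys {sz_ys ysP nb} => //= y0 ys IHys.
    by rewrite size_cat mulSn leq_add // (nbrP y0).1.
  apply: leq_trans sz_nb; rewrite -(size_map q).
  apply: leq_trans (card_size _); apply/subset_leq_card/fintype.subsetP => w'.
  rewrite unfold_in => /(qG.2 w w')[x1 [y1 [x1w y1w' Gxy]]].
  have [y0 y0ys py0] := ysP x1 (qpsi _ _ (etrans x1w (esym x0w))).
  have [y2 y2nb py2] := (nbrP y0).2 _ _ (esym py0) Gxy.
  rewrite -y1w' -(phiq _ _ py2); apply: map_f.
  by apply/flatten_mapP; exists y0.
have [s sw] : small_width (identify K (q x) (q y)).
  apply: (IHn _ _ _ (fun z => insub (q z))).
  - by rewrite -ltnS; apply: leq_trans leV; exact: card_identify.
  - exact: quotient_graph_identify.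
  - by move=> a b /phiq ->.
  - move=> a b; case: insubP => [a' _ va|na]; case: insubP => [b' _ vb|nb] //.
    + by case=> ab; apply: qpsi; rewrite -va -vb ab.
    + have e z : ~~ (q z \notin [:: q x; q y]) -> psi z = psi x.
        by rewrite negbK !inE => /orP[]/eqP/qpsi ->.
      by rewrite (e _ na) (e _ nb).
by exists (IdentStep nq s); rewrite /= geq_max degK.
Qed.

Lemma collapsible_small_width (L : Type) (phi : A -> L) :
  collapsible phi -> (exists x : A, True) ->
  forall (V : finType) (K : sgraph V) (q : A -> V), quotient_graph K q ->
    (forall x y, q x = q y <-> phi x = phi y) -> small_width K.
Proof.
move=> + [a _].
elim=> {L phi} [L phi const|L L' phi psi dphi mphi _ IH] V K q qG eqv.
  have card1 : #|V| = 1.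
    apply/eqP/fintype1P; exists (q a); rewrite /all_equal_to => v.
    by have [x xv] := qG.1 v; rewrite -xv; apply/eqv.
  exists (IdentDone K card1) => /=; apply/bigmax_leqP => x _.
  rewrite (_ : #|K x| = 0) //; apply: eq_card0 => y; rewrite unfold_in.
  have /fintype1P[v vP] : #|V| == 1 by apply/eqP.
  by rewrite (vP x) (vP y); exact: (adj_irr K v).
apply: (small_width_step dphi mphi IH qG) => x y; first by move/eqv.
by move=> /eqv /mphi.1.
Qed.

Lemma strict_twin_width_le (V : finType) (K : sgraph V) k :
  (exists s : identification_seq K, width s <= k) -> strict_twin_width K <= k.
Proof.
move=> [s sk]; rewrite /strict_twin_width; case: xgetP => // w _ [_].
by move=> /(_ s) /leq_trans; apply.
Qed.

Lemma collapsible_twin_width (L : Type) (phi : A -> L) :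
  collapsible phi -> injective phi -> strict_twin_width G <= c * d.
Proof.
(* Without vertices there is no identification sequence, and the strict twin-width has its default
   value 0. *)
move=> cphi inj; have [nA|/forallNP nA] := pselect (exists x : A, True); last first.
  rewrite /strict_twin_width; case: xgetP => // w _ [[s _]].
  case: s => [/eqP/fintype1P[x _]|u]; by [case: (nA x)|case: (nA u)].
apply: strict_twin_width_le.
apply: (collapsible_small_width cphi nA (q := id)); last first.
  by move=> x y; split=> [->|/inj].
by split=> [v|u v Kuv]; [exists v|exists u, v].
Qed.
End Collapse.

(** * Lamp configurations *)

Local Open Scope fset_scope.

Definition lamps := {fset int}.

Definition lxor (f g : lamps) : lamps := (f `\` g) `|` (g `\` f).
Notation "f :+: g" := (lxor f g) (at level 50, left associativity).

Definition shift (j : int) (f : lamps) : lamps := [fset (x + j)%R | x in f].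

(** The enumeration 0, -1, 1, -2, ... of the integers. Its virtue is [code_shift]: a translation by
    j changes codes by at most 2 |j|. *)
Definition code (x : int) : nat :=
  match x with Posz n => n.*2 | Negz n => n.*2.+1 end.

Definition pos (n : nat) : int := if odd n then Negz n./2 else Posz n./2.

Definition bit (n : nat) : lamps := [fset pos n].

(* The representative of the node of level n above the leaf f. *)
Definition mask (n : nat) (f : lamps) : lamps := [fset x in f | n <= code x].

Lemma in_lxor f g x : (x \in f :+: g) = (x \in f) (+) (x \in g).
Proof. by rewrite !inE; case: (x \in f); case: (x \in g). Qed.

Lemma in_mask n f x : (x \in mask n f) = (x \in f) && (n <= code x).
Proof. by rewrite !inE. Qed.

Lemma in_shift j f x : (x \in shift j f) = ((x - j)%R \in f).
Proof.
apply/imfsetP/idP => [[y /= yf ->]|xf]; first by rewrite GRing.addrK.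
by exists (x - j)%R => //=; rewrite GRing.subrK.
Qed.

Lemma codeK : cancel code pos.
Proof.
case=> n; rewrite /pos /= odd_double /= ?doubleK //.
by rewrite uphalf_double.
Qed.

Lemma posK : cancel pos code.
Proof.
move=> n; have := odd_double_half n; rewrite /pos.
by case: (odd n); rewrite /= ?add0n ?add1n.
Qed.

Lemma in_bit n x : (x \in bit n) = (code x == n).
Proof. by rewrite inE -(can_eq codeK) posK. Qed.

Definition lampE := (in_lxor, in_mask, in_shift, in_bit, in_fset0).

Lemma lxorC f g : f :+: g = g :+: f.
Proof. by apply/fsetP => x; rewrite !lampE addbC. Qed.

Lemma lxorA f g h : f :+: (g :+: h) = f :+: g :+: h.
Proof. by apply/fsetP => x; rewrite !lampE addbA. Qed.

Lemma lxor0 f : f :+: fset0 = f.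
Proof. by apply/fsetP => x; rewrite !lampE addbF. Qed.

Lemma lxorxx f : f :+: f = fset0.
Proof. by apply/fsetP => x; rewrite !lampE addbb. Qed.

Lemma lxor0l f : fset0 :+: f = f.
Proof. by rewrite lxorC lxor0. Qed.

Lemma lxorK f g : f :+: g :+: g = f.
Proof. by rewrite -lxorA lxorxx lxor0. Qed.

Lemma lxorKl f g : f :+: (f :+: g) = g.
Proof. by rewrite lxorA lxorxx lxor0l. Qed.

Lemma lxorAC f g h : f :+: g :+: h = f :+: h :+: g.
Proof. by rewrite -lxorA (lxorC g) lxorA. Qed.

Lemma mask0 f : mask 0 f = f.
Proof. by apply/fsetP => x; rewrite !lampE andbT. Qed.

Lemma mask_lxor n f g : mask n (f :+: g) = mask n f :+: mask n g.
Proof. by apply/fsetP => x; rewrite !lampE; case: (_ <= _); rewrite ?andbF ?andbT. Qed.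

Lemma mask_mask n m f : mask n (mask m f) = mask (maxn n m) f.
Proof. by apply/fsetP => x; rewrite !lampE geq_max -andbA; congr andb; rewrite andbC. Qed.

Lemma maskS n f : mask n.+1 (mask n f) = mask n.+1 f.
Proof. by rewrite mask_mask (maxn_idPl _). Qed.

Lemma mask_id n f : mask n (mask n f) = mask n f.
Proof. by rewrite mask_mask maxnn. Qed.

Lemma mask_bit n m : mask n (bit m) = if n <= m then bit m else fset0.
Proof.
apply/fsetP => x; case: leqP => nm; rewrite !lampE; case: eqP => //= -> //.
by apply/negbTE; rewrite -ltnNge.
Qed.

Lemma mask_sibling n f : mask n.+1 (f :+: bit n) = mask n.+1 f.
Proof. by rewrite mask_lxor mask_bit ltnn lxor0. Qed.

Lemma mask_eventually f : exists L, forall n, L <= n -> mask n f = fset0.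
Proof.
exists (\max_(x <- enum_fset f) (code x).+1) => n Ln; apply/fsetP => x.
rewrite !lampE; apply/negbTE; apply/andP => -[xf nx].
have := @leq_bigmax_seq _ (enum_fset f) predT (fun x => (code x).+1) (x : int) xf isT.
by move=> /= h; have := leq_trans h Ln; rewrite ltnNge nx.
Qed.

Lemma shift_lxor j f g : shift j (f :+: g) = shift j f :+: shift j g.
Proof. by apply/fsetP => x; rewrite !lampE. Qed.

Lemma shiftD i j f : shift i (shift j f) = shift (i + j)%R f.
Proof. by apply/fsetP => x; rewrite !lampE GRing.opprD GRing.addrA. Qed.

Lemma shift0 f : shift 0%R f = f.
Proof. by apply/fsetP => x; rewrite !lampE GRing.subr0. Qed.

Lemma shift_fset0 j : shift j fset0 = fset0.
Proof. by apply/fsetP => x; rewrite !lampE. Qed.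

Lemma code_shift x j : code (x + j)%R <= code x + (absz j).*2.
Proof.
have codeE y : code y = if (0 <= y)%R then (absz y).*2 else (absz y).*2.-1.
  by case: y => n //=; rewrite doubleS.
rewrite !codeE; case: ifP => hxj; case: ifP => hx; lia.
Qed.

(** A lamp of code below [n] keeps a code below [n] + 2 |j|, so a node of level [n] has a
    well-defined image at that higher level although the shift does not preserve the tree. *)
Lemma mask_shift n j f : mask (n + (absz j).*2) (shift j (mask n f)) =
  mask (n + (absz j).*2) (shift j f).
Proof.
apply/fsetP => x; rewrite !lampE -!andbA; congr andb; apply/andP/idP => [[]//|h].
split=> //; have := code_shift (x - j)%R j; rewrite GRing.subrK.
by move=> h2; lia.
Qed.

Lemma maskS_cases n f :
  mask n.+1 f = mask n f \/ mask n.+1 f = mask n f :+: bit n.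
Proof.
have [pf|pf] := boolP (pos n \in f); [right|left]; apply/fsetP => x;
  rewrite !lampE; (have [e|e] := eqVneq (code x) n;
    [have -> : x = pos n by rewrite -e codeK|]);
  rewrite ?posK ?pf ?(negbTE pf) ?ltnn ?leqnn //= ?addbF; congr andb; lia.
Qed.

(* The leaf g lies below the node of level n above f. *)
Definition under (n : nat) (f g : lamps) : bool := mask n g == mask n f.

(** The leaves below a node are the disjoint union of those below its two children; as a sum modulo
    2, this mirrors the recursion of [zword]. *)
Lemma underS n f g : under n.+1 f g = under n f g (+) under n (f :+: bit n) g.
Proof.
rewrite /under mask_lxor mask_bit leqnn.
have E : (mask n.+1 g == mask n.+1 f) =
    (mask n g == mask n f) || (mask n g == mask n f :+: bit n).
  apply/eqP/orP => [e|[]/eqP e].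
  - case: (maskS_cases n g) (maskS_cases n f) => eg [] ef; move: e; rewrite eg ef => e.
    + by left; rewrite e.
    + by right; rewrite e.
    + by right; rewrite -e lxorK.
    + by left; apply/eqP; rewrite -[LHS](lxorK _ (bit n)) e lxorK.
  - by rewrite -maskS e maskS.
  - by rewrite -maskS e mask_lxor maskS mask_bit ltnn lxor0.
rewrite E; case: eqP => [-> /=|]; last by case: eqP.
case: eqP => //= e; have /fsetP/(_ (pos n)) := e.
by rewrite !lampE posK eqxx leqnn andbT; case: (_ \in _).
Qed.

Lemma under_self n f : under n f f.
Proof. exact: eqxx. Qed.

Lemma under_sibling n f : under n (f :+: bit n) f = false.
Proof.
have := underS n f f; rewrite !under_self /=; by case: under.
Qed.

(** * The tree of Klein groups *)

Local Open Scope quotient_scope.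

(* The generators attached to the leaves below the node of level n above f. *)
Fixpoint zword (n : nat) (f : lamps) : seq lamps :=
  if n is n'.+1 then zword n' f ++ zword n' (f :+: bit n') else [:: f].

Section Actions.
Variables (Y : Type) (act : lamps -> Y -> Y).

Definition run (w : seq lamps) (y : Y) : Y := foldl (fun y f => act f y) y w.

Definition klein_action : Prop :=
  (forall f y, act f (act f y) = y) /\
  forall n f y, run (zword n f ++ zword n (f :+: bit n)) y =
                run (zword n (f :+: bit n) ++ zword n f) y.

Lemma run_cat w1 w2 y : run (w1 ++ w2) y = run w2 (run w1 y).
Proof. by rewrite /run foldl_cat. Qed.

Hypothesis act_klein : klein_action.

Lemma run_rev w y : run (rev w) (run w y) = y.
Proof.
elim: w y => [|f w IH] y //; rewrite rev_cons -cats1 run_cat /= IH.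
by case: act_klein => [K _]; exact: K.
Qed.

Lemma run_revl w y : run w (run (rev w) y) = y.
Proof. by rewrite -{1}[w]revK run_rev. Qed.
End Actions.

(* Two words are equal in the presented group when they act alike whenever the
   relations hold; the universal property then needs no normal form. *)
Definition same_action (w1 w2 : seq lamps) : Prop :=
  forall (Y : Type) (act : lamps -> Y -> Y), klein_action act ->
  forall y, run act w1 y = run act w2 y.

Definition same_actionb (w1 w2 : seq lamps) : bool := `[< same_action w1 w2 >].

Lemma same_action_equiv : equiv_class_of same_actionb.
Proof.
split.
- by move=> w; apply/asboolP.
- by move=> w w'; apply: asbool_equiv_eq; split=> h Y act k y; rewrite h.
- by move=> w w' w'' /asboolP h /asboolP h'; apply/asboolP => Y act k y; rewrite h // h'.
Qed.

Canonical same_action_rel := EquivRelPack same_action_equiv.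

Definition klein := {eq_quot same_action_rel}.
HB.instance Definition _ := Choice.on klein.

Definition kpi (w : seq lamps) : klein := \pi_klein w.

Lemma kpiP w w' : same_action w w' <-> kpi w = kpi w'.
Proof.
split=> [h|]; first by apply/eqmodP/asboolP.
by move/eqmodP/asboolP.
Qed.

Lemma repr_kpi w : same_action (repr (kpi w)) w.
Proof. by apply/kpiP; rewrite /kpi reprK. Qed.

Lemma kpi_repr (u : klein) : kpi (repr u) = u.
Proof. by rewrite /kpi reprK. Qed.

Definition kmul (u v : klein) : klein := kpi (repr u ++ repr v).
Definition kinv (u : klein) : klein := kpi (rev (repr u)).

Lemma kpiM w w' : kmul (kpi w) (kpi w') = kpi (w ++ w').
Proof. by apply/kpiP => Y act k y; rewrite !run_cat !(repr_kpi _ k). Qed.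

Lemma kpiV w : kinv (kpi w) = kpi (rev w).
Proof.
apply/kpiP => Y act k y.
apply: (canLR (run_rev k _)); by rewrite (repr_kpi _ k) run_revl.
Qed.

Fact kmulA : associative kmul.
Proof. by move=> u v w; rewrite -[u]kpi_repr -[v]kpi_repr -[w]kpi_repr !kpiM catA. Qed.
Fact kmul1 : left_id (kpi [::]) kmul.
Proof. by move=> u; rewrite -[u]kpi_repr kpiM. Qed.
Fact kmul1r : right_id (kpi [::]) kmul.
Proof. by move=> u; rewrite -[u]kpi_repr kpiM cats0. Qed.
Fact kmulV : left_inverse (kpi [::]) kinv kmul.
Proof.
move=> u; rewrite -[u]kpi_repr kpiV kpiM; apply/kpiP => Y act k y.
by rewrite run_cat run_revl.
Qed.
Fact kmulVr : right_inverse (kpi [::]) kinv kmul.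
Proof.
move=> u; rewrite -[u]kpi_repr kpiV kpiM; apply/kpiP => Y act k y.
by rewrite run_cat run_rev.
Qed.

HB.instance Definition _ := isGroup.Build klein kmulA kmul1 kmul1r kmulV kmulVr.
Local Open Scope group_scope.

Section Lift.
Variables (Y : Type) (act : lamps -> Y -> Y).
Hypothesis act_klein : klein_action act.

Definition lift (u : klein) (y : Y) : Y := run act (repr u) y.

Lemma lift_kpi w y : lift (kpi w) y = run act w y.
Proof. exact: repr_kpi. Qed.

Lemma liftM u v y : lift (u * v) y = lift v (lift u y).
Proof. by rewrite lift_kpi run_cat. Qed.

Lemma lift1 y : lift 1 y = y.
Proof. by rewrite lift_kpi. Qed.
End Lift.

Definition z (n : nat) (f : lamps) : klein := kpi (zword n f).

Lemma kpi_cat w w' : kpi (w ++ w') = kpi w * kpi w'.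
Proof. by rewrite -kpiM. Qed.

Lemma klein_ind (P : klein -> Prop) :
  P 1 -> (forall u f, P u -> P (u * z 0 f)) -> forall u, P u.
Proof.
move=> P1 PM u; rewrite -[u]kpi_repr; elim/last_ind: (repr u) => [|w f IH] //.
by rewrite -cats1 kpi_cat; exact: PM.
Qed.

Lemma zS n f : z n.+1 f = z n f * z n (f :+: bit n).
Proof. exact: kpi_cat. Qed.

Lemma zC n f : z n f * z n (f :+: bit n) = z n (f :+: bit n) * z n f.
Proof. by rewrite -!kpi_cat; apply/kpiP => Y act [_ k] y; exact: k. Qed.

Lemma zz n f : z n f * z n f = 1.
Proof.
elim: n f => [|n IH] f.
  rewrite -kpi_cat; apply/kpiP => Y act [k _] y; exact: k.
by rewrite zS {2}zC mulgA -(mulgA _ _ (z n (f :+: bit n))) IH mulg1 IH.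
Qed.

Lemma zV n f : (z n f)^-1 = z n f.
Proof. by apply: (mulgI (z n f)); rewrite mulgV zz. Qed.

(** By [zC] the two halves of a sibling product may be exchanged, so lamps of code below [n] can be
    switched freely and [z n f] depends on the node alone. *)
Lemma z_bit n m f : (m < n)%N -> z n (f :+: bit m) = z n f.
Proof.
elim: n f => // n IH f; rewrite ltnS leq_eqVlt => /predU1P[->|mn].
  by rewrite !zS lxorK -zC.
by rewrite !zS lxorAC !IH.
Qed.

Lemma z_mask_le n m f : (m <= n)%N -> z n (mask m f) = z n f.
Proof.
elim: m => [|m IH] mn; first by rewrite mask0.
rewrite -(IH (ltnW mn)).
by case: (maskS_cases m f) => ->; rewrite // z_bit.
Qed.

Lemma z_mask n f : z n (mask n f) = z n f.
Proof. exact: z_mask_le. Qed.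

Lemma z_under n f g : under n f g -> z n g = z n f.
Proof. by move=> /eqP e; rewrite -z_mask e z_mask. Qed.

(** * Abelianisation of the tree group *)

Definition ab_act (f : lamps) (alpha : lamps -> bool) : lamps -> bool :=
  fun g => alpha g (+) (g == f).

Lemma run_ab n f (alpha : lamps -> bool) :
  run ab_act (zword n f) alpha = fun g => alpha g (+) under n f g.
Proof.
elim: n f alpha => [|n IH] f alpha.
  by apply/funext => g; rewrite /= /ab_act /under !mask0.
by rewrite run_cat !IH; apply/funext => g; rewrite underS addbA.
Qed.

Lemma ab_klein : klein_action ab_act.
Proof.
split=> [f alpha|n f alpha].
  by apply/funext => g; rewrite /ab_act -addbA addbb addbF.
by rewrite !run_cat !run_ab; apply/funext => g; rewrite addbAC.
Qed.

(* The image of u in the sum of copies of Z/2 indexed by the leaves. *)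
Definition ab (u : klein) : lamps -> bool := lift ab_act u (fun=> false).

Lemma ab1 : ab 1 = fun=> false.
Proof. exact: lift1 ab_klein _. Qed.

Lemma abMz u n f g : ab (u * z n f) g = ab u g (+) under n f g.
Proof. by rewrite /ab (liftM ab_klein) (lift_kpi ab_klein) run_ab. Qed.

Lemma lift_ab u alpha : lift ab_act u alpha = fun g => alpha g (+) ab u g.
Proof.
elim/klein_ind: u => [|u f IH].
  by rewrite ab1 (lift1 ab_klein); apply/funext => g; rewrite addbF.
rewrite (liftM ab_klein) IH (lift_kpi ab_klein) run_ab; apply/funext => g.
by rewrite abMz addbA.
Qed.

Lemma abM u v g : ab (u * v) g = ab u g (+) ab v g.
Proof. by rewrite {1}/ab (liftM ab_klein) lift_ab. Qed.

Lemma abz n f g : ab (z n f) g = under n f g.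
Proof. by rewrite -[z n f]mul1g abMz ab1. Qed.

Lemma abV u g : ab u^-1 g = ab u g.
Proof.
have : ab (u * u^-1) g = false by rewrite mulgV ab1.
by rewrite abM; case: (ab u g); case: (ab _ g).
Qed.

(** * Action of the lamps on the tree group *)

Section Translation.
Variable a : lamps.

Lemma zword_translate n f : map (lxor a) (zword n f) = zword n (a :+: f).
Proof. by elim: n f => //= n IH f; rewrite map_cat !IH lxorA. Qed.

Lemma translate_action (Y : Type) (act : lamps -> Y -> Y) :
  klein_action act -> klein_action (fun f => act (a :+: f)).
Proof.
move=> [k1 k2]; split=> [f y|n f y]; first exact: k1.
have E w y' : run (fun f => act (a :+: f)) w y' = run act (map (lxor a) w) y'.
  by rewrite /run; elim: w y' => //= g w IH y'; rewrite IH.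
by rewrite !E !map_cat !zword_translate lxorA k2.
Qed.

Lemma same_action_translate w w' :
  same_action w w' -> same_action (map (lxor a) w) (map (lxor a) w').
Proof.
move=> h Y act /translate_action/h k y.
have E w2 y' : run (fun f => act (a :+: f)) w2 y' = run act (map (lxor a) w2) y'.
  by rewrite /run; elim: w2 y' => //= g w2 IH y'; rewrite IH.
by rewrite -!E.
Qed.

Definition translate (u : klein) : klein := kpi (map (lxor a) (repr u)).

Lemma translate_kpi w : translate (kpi w) = kpi (map (lxor a) w).
Proof. by apply/kpiP; apply: same_action_translate; exact: repr_kpi. Qed.

Lemma translateM u v : translate (u * v) = translate u * translate v.
Proof.
rewrite -[u]kpi_repr -[v]kpi_repr -kpi_cat !translate_kpi map_cat.
exact: kpi_cat.
Qed.

Lemma translate1 : translate 1 = 1.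
Proof. exact: translate_kpi. Qed.

Lemma translate_z n f : translate (z n f) = z n (a :+: f).
Proof. by rewrite translate_kpi zword_translate. Qed.
End Translation.

Lemma translateD a b u : translate (a :+: b) u = translate a (translate b u).
Proof.
rewrite -[u]kpi_repr !translate_kpi -map_comp; congr kpi.
by apply: eq_map => f /=; rewrite lxorA.
Qed.

Lemma translate0 u : translate fset0 u = u.
Proof.
rewrite -[u]kpi_repr translate_kpi; congr kpi; rewrite -[RHS]map_id.
by apply: eq_map => f; rewrite lxor0l.
Qed.

Lemma translate_eq1 a u : (translate a u == 1) = (u == 1).
Proof.
apply/eqP/eqP => [e|->]; last exact: translate1.
by rewrite -[u]translate0 -(lxorxx a) translateD e translate1.
Qed.

Local Close Scope quotient_scope.

(* A derivation of klein counting modulo 2 the passages through the edge of the Bass-Serre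
   tree whose stabiliser is {1, z N fset0}. *)
Section Wall.
Variable N : nat.

Definition at_wall (u : klein) : bool := (u == 1) || (u == z N fset0).

Definition below_wall (n : nat) (f : lamps) : bool := (n <= N)%N && under N fset0 f.

(** To pass from the copy of T at [u] to the copy at [u * z n f], one descends to the node and
    climbs back. If the node is below the wall, this traverses the edge at [u] and the one at
    [u * z n f]; each counts when it is the chosen edge. *)
Definition crossing (u : klein) (n : nat) (f : lamps) : bool :=
  below_wall n f && (at_wall u (+) at_wall (u * z n f)).

Definition wall_act (f : lamps) (s : klein * bool) : klein * bool :=
  (s.1 * z 0 f, s.2 (+) crossing s.1 0 f).

(** Multiplication by [z N fset0] permutes the group {1, [z N fset0]}, so the edge is traversed
    twice or not at all. *)
Lemma crossing_top u f : crossing u N f = false.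
Proof.
rewrite /crossing /below_wall leqnn /=; case: (boolP (under N _ f)) => //= /z_under ->.
rewrite /at_wall -[X in _ (+) (X || _)](inj_eq (mulIg (z N fset0))).
rewrite -mulgA zz mulg1 mul1g [X in _ (+) (_ || X)](_ : _ = (u == 1)).
  by rewrite orbC addbb.
by rewrite -{2}[z N fset0]mul1g (inj_eq (mulIg _)).
Qed.

Lemma below_wallS n f : (n < N)%N -> below_wall n (f :+: bit n) = below_wall n f.
Proof.
by move=> nN; rewrite /below_wall /under mask_lxor mask_bit (leqNgt N n) nN lxor0.
Qed.

Lemma crossingS u n f :
  crossing u n.+1 f = crossing u n f (+) crossing (u * z n f) n (f :+: bit n).
Proof.
have [nN|] := ltnP n N; last first.
  rewrite leq_eqVlt => /predU1P[<-|Nn].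
    by rewrite !crossing_top /crossing /below_wall ltnn.
  by rewrite /crossing /below_wall !(leqNgt _ N) Nn (ltn_trans Nn) /=.
have e : below_wall n.+1 f = below_wall n f by rewrite /below_wall nN (ltnW nN).
rewrite /crossing below_wallS // e zS -mulgA; case: below_wall => //=.
by case: (at_wall u); case: (at_wall (u * z n f)); case: (at_wall (u * (_ * _))).
Qed.

Lemma run_wall n f u b :
  run wall_act (zword n f) (u, b) = (u * z n f, b (+) crossing u n f).
Proof.
elim: n f u b => [|n IH] f u b //.
by rewrite run_cat !IH zS crossingS mulgA addbA.
Qed.

Lemma wall_klein : klein_action wall_act.
Proof.
split=> [f [u b]|n f [u b]].
  rewrite /wall_act /= -mulgA zz mulg1 -addbA; congr pair.
  rewrite /crossing -mulgA zz mulg1; case: below_wall; rewrite ?addbF //=.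
  by case: (at_wall u); case: (at_wall (u * _)); case: b.
have zS' : z n.+1 (f :+: bit n) = z n.+1 f by rewrite z_bit.
have -> : zword n f ++ zword n (f :+: bit n) = zword n.+1 f by [].
have -> : zword n (f :+: bit n) ++ zword n f = zword n.+1 (f :+: bit n).
  by rewrite /= lxorK.
rewrite !run_wall zS' /crossing zS'; congr (_, _ (+) (_ && _)).
rewrite /below_wall; have [nN|//] := leqP n.+1 N.
by have := below_wallS f nN; rewrite /below_wall (ltnW nN) /= => ->.
Qed.

Definition beyond (u : klein) : bool := (lift wall_act u (1, false)).2.

Lemma lift_wall u : lift wall_act u (1, false) = (u, beyond u).
Proof.
rewrite /beyond; elim/klein_ind: u => [|u f]; first by rewrite !(lift1 wall_klein).
by rewrite !(liftM wall_klein) => ->; rewrite !(lift_kpi wall_klein).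
Qed.

Lemma beyond1 : beyond 1 = false.
Proof. by rewrite /beyond (lift1 wall_klein). Qed.

Lemma beyondMz u n f : beyond (u * z n f) = beyond u (+) crossing u n f.
Proof.
by rewrite {1}/beyond (liftM wall_klein) lift_wall (lift_kpi wall_klein) run_wall.
Qed.

Lemma beyond_change u f : beyond (u * z 0 f) != beyond u ->
  under N fset0 f /\ (at_wall u || at_wall (u * z 0 f)).
Proof.
rewrite beyondMz; case C: (crossing u 0 f); rewrite ?addbF ?eqxx // => _.
move: C; rewrite /crossing /below_wall /= => /andP[-> ]; split=> //.
by case: at_wall b.
Qed.

Lemma beyond_at_wall u : at_wall u -> beyond u = false.
Proof.
case/orP=> /eqP ->; first exact: beyond1.
by rewrite -[z N _]mul1g beyondMz beyond1 crossing_top.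
Qed.
End Wall.

Section Power.
Variable m : nat.
Let N := m.+1.
Let w := z m fset0.
Let w' := z m (bit N).

(** [w] fixes the lower end of the wall edge but moves the edge, and [w'] fixes a node on the other
    side. Their product is therefore a translation whose axis runs through the wall. *)
Definition shear : klein := w * w'.

Let underE : under m fset0 fset0 /\ under m (bit N) fset0 = false /\
  under m fset0 (bit N) = false /\ under m (bit N) (bit N) /\
  under m fset0 (bit m) = false /\ under m (bit N) (bit m) = false /\
  under N fset0 fset0 /\ under N fset0 (bit N) = false /\ under N fset0 (bit m).
Proof.
have m0 n : mask n fset0 = fset0 by apply/fsetP => x; rewrite !lampE.
have b0 n : bit n == fset0 = false.
  by apply/negbTE/fset0Pn; exists (pos n); rewrite inE.
have bb : bit m == bit N = false.
  apply/negbTE/negP => /eqP/fsetP/(_ (pos m)); rewrite !lampE posK eqxx.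
  by rewrite ltn_eqF.
rewrite /under !m0 !mask_bit leqnn leqnSn /N ltnn leqnn !eqxx !b0 bb.
by rewrite (eq_sym fset0) b0.
Qed.

Let ab_shear i g : ab (shear ^+ i) g = odd i && (under m fset0 g (+) under m (bit N) g).
Proof.
elim: i => [|i IH]; first by rewrite expg0 ab1.
rewrite expgSr abM IH /shear abM !abz /=; case: (odd i) => //=.
by rewrite addbb.
Qed.

(** Three leaves suffice to keep elements off the wall in the abelianisation: [fset0] and [bit m]
    are the two sides below the wall node, and [bit N] is outside. *)
Let at_wall_ab u : at_wall N u ->
  (ab u fset0 = ab u (bit m)) /\ ab u (bit N) = false.
Proof.
have [_ [_ [_ [_ [_ [_ [e1 [e2 e3]]]]]]]] := underE.
by case/orP=> /eqP ->; rewrite ?ab1 // !abz e1 e2 e3.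
Qed.

Let off_wall i : at_wall N (shear ^+ i * w) = false.
Proof.
apply/negP => /at_wall_ab[]; rewrite !abM !ab_shear !abz.
have [-> [-> [-> [-> [-> [-> _]]]]]] := underE.
by case: (odd i).
Qed.

Let off_wall' i : at_wall N ((shear ^+ i)^-1 * w') = false.
Proof.
apply/negP => /at_wall_ab[]; rewrite !abM !abV !ab_shear !abz.
have [-> [-> [-> [-> [-> [-> _]]]]]] := underE.
by case: (odd i).
Qed.

Let far u : crossing N u m (bit N) = false.
Proof.
rewrite /crossing /below_wall.
by have [_ [_ [_ [_ [_ [_ [_ [-> _]]]]]]]] := underE; rewrite andbF.
Qed.

Let near u : crossing N u m fset0 = at_wall N u (+) at_wall N (u * w).
Proof. by rewrite /crossing /below_wall leqnSn /= under_self. Qed.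

(** Only the first factor [w] crosses the wall. A later crossing would put a power of [shear] in the
    wall group, where [beyond] vanishes. *)
Lemma beyond_shear i : beyond N (shear ^+ i.+1).
Proof.
elim: i => [|i IH]; rewrite expgSr mulgA beyondMz far addbF beyondMz near off_wall addbF.
  by rewrite expg0 beyond1 /at_wall eqxx.
case E: (at_wall N _); last by rewrite IH.
by move: IH; rewrite (beyond_at_wall E).
Qed.

(** The inverse starts with [w'], away from the wall, and none of the later products lies in the
    wall group, so no factor [w] crosses. *)
Lemma beyond_shearV i : beyond N (shear ^- i.+1) = false.
Proof.
have offE j : at_wall N (shear ^- j.+1) = false.
  apply/negP => E.
  suff : at_wall N (shear ^+ j.+1) by move/beyond_at_wall; rewrite beyond_shear.
  rewrite -[_ ^+ _]invgK; case/orP: E => /eqP ->; first by rewrite invg1 /at_wall eqxx.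
  by rewrite zV /at_wall eqxx orbT.
have step j : shear ^- j.+1 = shear ^- j * w' * w.
  by rewrite expgS invgM /shear invgM !zV mulgA.
elim: i => [|i IH]; rewrite step beyondMz beyondMz far addbF near -step offE off_wall'.
  by rewrite expg0 invg1 beyond1.
by rewrite IH.
Qed.

Lemma translate_shear a : mask m a = fset0 -> translate a shear = shear.
Proof.
move=> a0; rewrite translateM !translate_z.
by congr (_ * _); apply: z_under; rewrite /under mask_lxor a0 lxor0l.
Qed.
End Power.

(** * A criterion for inaccessibility *)

Lemma injective_escapes (T : eqType) (u : nat -> T) (s : seq T) :
  injective u -> exists N, forall n, (N <= n)%N -> u n \notin s.
Proof.
move=> inj; elim: s => [|x s [N Ns]]; first by exists 0.
have [[m mx]|no] := pselect (exists m, u m = x).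
  exists (maxn N m.+1) => n; rewrite geq_max => /andP[/Ns ns mn].
  by rewrite inE negb_or ns andbT -mx; apply/eqP => /inj nm; rewrite nm ltnn in mn.
exists N => n /Ns ns; rewrite inE negb_or ns andbT; apply/eqP => ux.
by apply: no; exists n.
Qed.

(** * From walks to rays *)

Section LoopErasure.
Variables (V : choiceType) (G : sgraph V) (g : nat -> V).
Hypothesis step : forall n, g n.+1 = g n \/ G (g n) (g n.+1).
Hypothesis leaves : forall v, exists N, forall n, (N <= n)%N -> g n <> v.

Lemma last_visit n : exists m, [/\ (n <= m)%N, g m = g n &
  forall k, (m < k)%N -> g k <> g n].
Proof.
have [N NP] := leaves (g n).
have ex : exists k, (n <= k)%N && (g k == g n) by exists n; rewrite leqnn eqxx.
have ub k : (n <= k)%N && (g k == g n) -> (k <= N)%N.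
  by case/andP=> _ /eqP gk; rewrite leqNgt; apply/negP => /ltnW /NP.
case: (ex_maxnP ex ub) => m /andP[nm /eqP gm] mmax.
exists m; split=> // k mk gk; have := mmax k.
by rewrite gk eqxx (leq_trans nm (ltnW mk)) leqNgt mk => /(_ isT).
Qed.

(** Each vertex is left at its last visit, so none recurs. The bound [k <= f k] lets eventual
    properties of the walk pass to the ray. *)
Lemma loop_erasure : exists (r : ray G) (f : nat -> nat),
  (forall k, (k <= f k)%N) /\ forall k, r k = g (f k).
Proof.
have [l lP] := choice last_visit.
pose f := fix f k := if k is k'.+1 then l (f k').+1 else l 0.
have lf k : l (f k) = f k.
  suff E n : l (l n) = l n by case: k => [|k]; exact: E.
  have [nl gl ul] := lP n; have [nl2 gl2 ul2] := lP (l n).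
  apply/eqP; rewrite eqn_leq nl2 andbT leqNgt; apply/negP => /ul.
  by rewrite gl2 gl.
have lt_f k : (f k < f k.+1)%N by have [] := lP (f k).+1.
have mono k j : (k < j)%N -> (f k < f j)%N.
  elim: j => // j IH; rewrite ltnS leq_eqVlt => /predU1P[->//|/IH kj].
  exact: ltn_trans kj (lt_f j).
have new k n : (f k < n)%N -> g n <> g (f k).
  by move=> kn; have [_ _ /(_ n)] := lP (f k); rewrite lf; apply.
have inj : injective (g \o f).
  move=> i j /= gij; case: (ltngtP i j) => // /mono /new; rewrite /= gij; by case.
have adj k : G ((g \o f) k) ((g \o f) k.+1).
  have [_ /= -> _] := lP (f k).+1.
  case: (step (f k)) => // same; case: (new k (f k).+1 (ltnSn _) same).
exists (Ray inj adj), f; split=> //; elim=> // k IH.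
exact: leq_ltn_trans IH (lt_f k).
Qed.
End LoopErasure.

Section Connected.
Variables (V : choiceType) (G : sgraph V) (F : {fset {fset V}}).

Lemma same_component_refl x : same_component_minus G F x x.
Proof. by exists [::]. Qed.

Lemma same_component_trans x y z : same_component_minus G F x y ->
  same_component_minus G F y z -> same_component_minus G F x z.
Proof.
move=> [p pp <-] [q qq <-]; exists (p ++ q); last by rewrite last_cat.
by rewrite cat_path pp.
Qed.

Lemma same_component_edge x y : G x y -> [fset x; y]%fset \notin F ->
  same_component_minus G F x y.
Proof. by move=> xy nF; exists [:: y] => //=; rewrite xy nF. Qed.

Lemma same_component_sym x y : same_component_minus G F x y ->
  same_component_minus G F y x.
Proof.
move=> [p + <-] {y}; elim: p x => [|y p IH] x /=.
  by move=> _; exact: same_component_refl.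
move=> /andP[/andP[xy nF] /IH]; move/same_component_trans; apply.
by apply: same_component_edge; rewrite ?(adj_sym G y x) // fsetUC.
Qed.
End Connected.

Lemma ray_equiv_refl (V : choiceType) (G : sgraph V) (r : ray G) : ray_equiv r r.
Proof.
exists (fun i => (r i, [::])); split=> [i|i j nij z].
  by split=> //=; exists i.
by rewrite /= !inE => -[/eqP -> /eqP /ray_inj ij]; rewrite ij eqxx in nij.
Qed.

Section Inseparable.
Variables (Gamma : groupType) (S : {fset Gamma}).
Hypothesis gen : generates S.

Let letter (x : Gamma) := (x \in S) || (x^-1 \in S).

Lemma cayley_step g x : letter x -> g * x = g \/ Cay S g (g * x).
Proof.
move=> lx; have [->|nx] := eqVneq x 1; first by left; rewrite mulg1.
right; rewrite /= /cayley_adj; apply/andP; split.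
  by apply: contra nx => /eqP e; apply/eqP; apply: (mulgI g); rewrite mulg1 -e.
apply/existsP; case/orP: lx => xS; exists [` xS]%fset => /=; rewrite ?eqxx //.
by rewrite mulgK eqxx orbT.
Qed.

Lemma cayley_letter g h : Cay S g h -> exists2 x, letter x & h = g * x.
Proof.
rewrite /= /cayley_adj => /andP[_ /existsP[s /orP[]/eqP e]].
  by exists (val s) => //; rewrite /letter (valP s).
by exists (val s)^-1; rewrite /letter ?invgK ?(valP s) ?orbT // e mulgK.
Qed.

Lemma cayley_translate k g h : Cay S (k * g) (k * h) = Cay S g h.
Proof.
rewrite /= /cayley_adj; congr (_ && _); first by rewrite (inj_eq (mulgI k)).
by apply: eq_existsb => s; rewrite -!mulgA !(inj_eq (mulgI k)).
Qed.

Lemma cayley_path_translate k x p :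
  path (Cay S) (k * x) [seq k * y | y <- p] = path (Cay S) x p.
Proof.
by elim: p x => //= y p IH x; congr andb; [exact: cayley_translate|exact: IH].
Qed.

Lemma cayley_connected g h : exists2 p, path (Cay S) g p & last g p = h.
Proof.
have [w wS e] := gen (g^-1 * h).
have -> : h = g * \prod_(x <- w) x by rewrite -e mulVKg.
elim: w wS g {e} => [|x w IH] /= => [_ g|/andP[lx /IH {}IH] g].
  by exists [::]; rewrite // big_nil mulg1.
have [p pp lp] := IH (g * x); rewrite big_cons mulgA.
have [e|adj] := cayley_step g lx; first by rewrite e in pp lp *; exists p.
by exists (g * x :: p) => //=; apply/andP.
Qed.

Lemma expg_injective (t : Gamma) (B : Gamma -> bool) :
  (forall n, B (t ^+ n.+1)) -> (forall n, ~~ B (t ^- n.+1)) ->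
  injective (fun n => t ^+ n).
Proof.
move=> tB tnB; suff lt i j : (i < j)%N -> t ^+ i != t ^+ j.
  by move=> i j ij; case: (ltngtP i j) => // /lt; rewrite ij eqxx.
move=> ij; apply/eqP => e.
have e1 : t ^+ (j - i).-1.+1 = 1.
  by rewrite prednK ?subn_gt0 // expgnFr ?(ltnW ij) // -e mulgV.
by have := tnB (j - i).-1; rewrite e1 invg1 -e1 tB.
Qed.

(** [F] touches finitely many vertices, so only finitely many translates of a given path by powers
    of [t] can meet it. *)
Lemma far_connected (t : Gamma) (F : {fset {fset Gamma}}) g h :
  injective (fun n => t ^+ n) ->
  exists N, forall n, (N <= n)%N ->
    same_component_minus (Cay S) F (t ^+ n * g) (t ^+ n * h).
Proof.
move=> inj; have [w wS e] := gen (g^-1 * h).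
have -> : h = g * \prod_(x <- w) x by rewrite -e mulVKg.
elim: w wS g {e} => [|x w IH] /= => [_ g|/andP[lx /IH {}IH] g].
  by exists 0 => n _; rewrite big_nil mulg1; exact: same_component_refl.
have [N NP] := IH (g * x).
have injg : injective (fun n => t ^+ n * g) by move=> i j /mulIg /inj.
pose touched := flatten [seq enum_fset f | f : {fset Gamma} <- enum_fset F].
have [M MP] := injective_escapes touched injg.
exists (maxn N M) => n; rewrite geq_max => /andP[/NP nN /MP nM].
rewrite big_cons (mulgA g); apply: same_component_trans nN.
rewrite mulgA; have [->|adj] := cayley_step (t ^+ n * g) lx.
  exact: same_component_refl.
apply: same_component_edge => //; apply: contra nM => fF.
apply/flattenP; exists (enum_fset [fset t ^+ n * g; t ^+ n * g * x]%fset).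
  by apply: (map_f (fun f : {fset Gamma} => enum_fset f)).
by have : t ^+ n * g \in [fset t ^+ n * g; t ^+ n * g * x]%fset by rewrite !inE eqxx.
Qed.

(** A word for [t] is read periodically and its loops are erased. [P] consists of the products of
    its proper prefixes, so the ray stays close to the powers of [t]. *)
Lemma power_ray (t : Gamma) : injective (fun n => t ^+ n) ->
  exists (r : ray (Cay S)) (P : seq Gamma), forall N, exists K, forall k,
    (K <= k)%N -> exists n q, [/\ (N <= n)%N, q \in P & r k = t ^+ n * q].
Proof.
move=> inj; have [w wS e] := gen t.
have L_gt0 : (0 < size w)%N.
  case: w e {wS} => // e; have : t ^+ 1 = t ^+ 0 by rewrite expg1 expg0 e big_nil.
  by move/inj.
pose L := size w.
pose pre j := \prod_(x <- take j w) x.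
pose g n := t ^+ (n %/ L) * pre (n %% L)%N.
have preL : pre L = t by rewrite /pre take_size -e.
have gS n : g n.+1 = g n * nth 1 w (n %% L)%N.
  have lt : (n %% L < L)%N by rewrite ltn_mod.
  have preS : pre (n %% L).+1 = pre (n %% L)%N * nth 1 w (n %% L)%N.
    by rewrite /pre (take_nth 1) // -cats1 big_cat big_seq1.
  have [dL|dL] := boolP (L %| n.+1)%N.
    have eL : (n %% L).+1 = L.
      apply/eqP; rewrite eqn_leq lt dvdn_leq // /dvdn -addn1 modnDml addn1; exact: dL.
    rewrite /g modnS divnS // dL /= -mulgA -preS eL preL.
    by rewrite /pre take0 big_nil mulg1 add1n expgSr.
  rewrite /g modnS divnS // (negbTE dL) add0n -mulgA; congr (_ * _).
  exact: preS.
have step n : g n.+1 = g n \/ Cay S (g n) (g n.+1).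
  rewrite gS; apply: cayley_step; apply: (allP wS); apply: mem_nth.
  by rewrite ltn_mod.
pose P := [seq pre j | j <- iota 0 L].
have gP n : pre (n %% L)%N \in P by apply: map_f; rewrite mem_iota ltn_mod L_gt0.
have leaves v : exists N, forall n, (N <= n)%N -> g n <> v.
  have [N NP] := injective_escapes [seq v * q^-1 | q <- P] inj.
  exists (N * L)%N => n Nn gv; have := NP (n %/ L)%N; rewrite leq_divRL //.
  move=> /(_ Nn)/negP; apply; apply/mapP; exists (pre (n %% L)%N) => //.
  by rewrite -gv mulgK.
have [r [f [ff rf]]] := loop_erasure step leaves.
exists r, P => N; exists (N * L)%N => k Nk.
exists (f k %/ L)%N, (pre (f k %% L)%N); split=> //.
by rewrite leq_divRL // (leq_trans Nk).
Qed.

Definition almost_invariant (B : Gamma -> bool) : Prop :=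
  forall s, exists E : seq Gamma, forall g, B g != B (g * s) -> g \in E.

Lemma power_ray_eventually (t : Gamma) (B : Gamma -> bool) (b : bool) (r : ray (Cay S))
    (P : seq Gamma) :
  almost_invariant B -> injective (fun n => t ^+ n) ->
  (forall n, B (t ^+ n.+1) = b) ->
  (forall N, exists K, forall k, (K <= k)%N ->
    exists n q, [/\ (N <= n)%N, q \in P & r k = t ^+ n * q]) ->
  exists K, forall k, (K <= k)%N -> B (r k) = b.
Proof.
move=> aB inj tB rP.
have [N NP] : exists N, forall n q, (N <= n)%N -> q \in P -> B (t ^+ n * q) = b.
  elim: P {rP} => [|q P [N NP]]; first by exists 0.
  have [E EP] := aB q; have [M MP] := injective_escapes E inj.
  exists (maxn N M.+1) => n q'; rewrite geq_max => /andP[Nn Mn].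
  rewrite inE => /predU1P[->|]; last exact: NP.
  have := MP n (ltnW Mn); case: n Mn {Nn} => // n _; apply: contraNeq => ne.
  by apply: EP; rewrite tB eq_sym.
have [K KP] := rP N; exists K => k /KP[n [q [Nn qP ->]]]; exact: NP.
Qed.

(** Each joining path passes from outside [B] into [B], hence through a vertex of the finite
    coboundary of [B]; infinitely many disjoint paths would need infinitely many such vertices. *)
Lemma power_ends_differ (B : Gamma -> bool) (r r' : ray (Cay S)) :
  almost_invariant B ->
  (exists K, forall k, (K <= k)%N -> B (r k) = true) ->
  (exists K, forall k, (K <= k)%N -> B (r' k) = false) ->
  ~ ray_equiv r' r.
Proof.
move=> aB [K KP] [K' KP'] [P [Pjoin Pdisj]].
have [E EP] := choice aB.
pose letters := enum_fset S ++ [seq x^-1 | x <- enum_fset S].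
(* The initial segments of both rays, where the value of [B] is not controlled, are added to the
   coboundary. *)
pose bad := flatten [seq E x | x <- letters] ++
  [seq r k | k <- iota 0 K] ++ [seq r' k | k <- iota 0 K'].
have badE g h : Cay S g h -> B g != B h -> g \in bad.
  move=> /cayley_letter[x lx ->] ne; rewrite mem_cat; apply/orP; left.
  apply/flatten_mapP; exists x; last exact: EP.
  rewrite mem_cat; case/orP: lx => xS; first by rewrite [_ \in _]xS.
  by apply/orP; right; rewrite -[x]invgK; apply: map_f.
have meets i : exists2 z, z \in bad & z \in (P i).1 :: (P i).2.
  have [pp _ [a ra] [b rb]] := Pjoin i.
  have [aK'|K'a] := ltnP a K'.
    exists (P i).1; rewrite ?mem_head // -ra !mem_cat.
    by rewrite (map_f (fun k => r' k)) ?orbT // mem_iota.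
  have [bK|Kb] := ltnP b K.
    exists (last (P i).1 (P i).2); rewrite ?mem_last // -rb !mem_cat.
    by rewrite (map_f (fun k => r k)) ?orbT // mem_iota.
  have: B (P i).1 = false by rewrite -ra KP'.
  have: B (last (P i).1 (P i).2) = true by rewrite -rb KP.
  elim: {rb ra}(P i).2 (P i).1 pp => [|y p IH] x /=; first by move=> _ ->.
  move=> /andP[xy pp] lt Bx; case By: (B y).
    by exists x; rewrite ?mem_head // (badE _ _ xy) // Bx By.
  by have [z zb zp] := IH _ pp lt By; exists z; rewrite // inE zp orbT.
pose z i := projT1 (cid2 (meets i)).
have zbad i : z i \in bad by rewrite /z; case: cid2.
have zP i : z i \in (P i).1 :: (P i).2 by rewrite /z; case: cid2.
have inj : injective z.
  move=> i j zij; apply/eqP/negPn/negP => /Pdisj/(_ (z i)); apply; split=> //.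
  by rewrite zij.
have [N /(_ N (leqnn N))] := injective_escapes bad inj.
by rewrite zbad.
Qed.

(* Each of the K-translates of a shortest path from K a to K b meets F, and by
   minimality the translates have no edge in common. *)
Lemma separating_edges (K : seq Gamma) (F : {fset {fset Gamma}}) (a b x y : Gamma) :
  uniq K -> (forall k l, k \in K -> l \in K -> k^-1 * l \in K) ->
  (exists k, k \in K) ->
  (forall k, k \in K -> same_component_minus (Cay S) F x (k * a)) ->
  (forall k, k \in K -> same_component_minus (Cay S) F y (k * b)) ->
  ~ same_component_minus (Cay S) F x y -> (size K <= #|` F|)%N.
Proof.
move=> uK divK [k0 k0K] xa yb nxy.
have oneK : 1 \in K by rewrite -(mulVg k0) divK.
have invK k : k \in K -> k^-1 \in K by move=> kK; rewrite -[k^-1]mulg1 divK.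
have mulK k l : k \in K -> l \in K -> k * l \in K.
  by move=> kK lK; rewrite -[k]invgK divK // invK.
pose joins n := exists k l p, [/\ k \in K, l \in K, path (Cay S) (k * a) p,
  last (k * a) p = l * b & size p = n].
have ex : exists n, `[< joins n >].
  have [p pp lp] := cayley_connected a b.
  by exists (size p); apply/asboolP; exists 1, 1, p; rewrite !mul1g.
case: (ex_minnP ex) => n /asboolP[k1 [l1 [p [k1K l1K pp lp sp]]]] nmin.
pose v i := nth 1 (k1 * a :: p) i.
have vlast i : (i <= n)%N -> last (k1 * a) (take i p) = v i.
  rewrite -sp /v; elim: i (k1 * a) (p) => [|i IH] z [|z' q] //= iq.
  exact: IH.
(* If [v j] were a translate of [v i], the piece between them could be cut out and the rest
   translated by an element of [K]: this would again join a translate of [a] to one of [b], with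
   fewer edges. *)
have shortest i j k : (i < j)%N -> (j <= n)%N -> k \in K -> v j <> k * v i.
  move=> ij jn kK e; have ilen := leq_trans (ltnW ij) jn.
  have : (n <= i + (n - j))%N.
    apply: nmin; apply/asboolP.
    exists k1, (k^-1 * l1), (take i p ++ [seq k^-1 * y | y <- drop j p]).
    split; rewrite ?mulK ?invK //.
    - rewrite cat_path vlast //; apply/andP; split.
        by move: pp; rewrite -{1}(cat_take_drop i p) cat_path => /andP[].
      have -> : v i = k^-1 * v j by rewrite e mulKg.
      rewrite cayley_path_translate -vlast //.
      by move: pp; rewrite -{1}(cat_take_drop j p) cat_path => /andP[].
    - rewrite last_cat vlast //.
      have -> : v i = k^-1 * v j by rewrite e mulKg.
      rewrite last_map -vlast // -last_cat cat_take_drop lp.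
      by rewrite mulgA.
    - by rewrite size_cat size_map size_drop size_takel sp.
  by move=> le; lia.
have hits k : k \in K -> exists i, (i < n)%N /\ [fset k * v i; k * v i.+1]%fset \in F.
  move=> kK; apply: contrapT => /forallNP none; apply: nxy.
  apply: same_component_trans (xa _ (mulK _ _ kK k1K)) _.
  apply: same_component_trans (same_component_sym (yb _ (mulK _ _ kK l1K))).
  exists [seq k * z | z <- p]; last by rewrite -mulgA last_map lp mulgA.
  have nthk i : (i <= n)%N -> nth 1 (k * (k1 * a) :: [seq k * z | z <- p]) i = k * v i.
    by move=> i_n; rewrite -map_cons (nth_map 1) //= sp ltnS.
  apply/(pathP 1) => i; rewrite size_map sp => lt_in; rewrite -mulgA.
  rewrite (nthk i (ltnW lt_in)) (_ : nth 1 [seq k * z | z <- p] i = k * v i.+1);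
    last exact: (nthk i.+1 lt_in).
  rewrite [X in X && _]cayley_translate.
  apply/andP; split; first by have /(pathP 1) := pp; apply; rewrite sp.
  by apply/negP => iF; apply: (none i).
have [f fP] := choice (fun k : {k | k \in K} => hits _ (valP k)).
pose e k := if insub k is Some k'
  then [fset k * v (f k'); k * v (f k').+1]%fset else fset0.
rewrite -(size_map e); apply: uniq_leq_size.
  rewrite map_inj_in_uniq // => k l kK lK; rewrite /e !insubT.
  set i := f _; set j := f _.
  have [lt_in _] := fP (Sub k kK); have [lt_jn _] := fP (Sub l lK).
  rewrite -/i -/j in lt_in lt_jn => eF.
  have sameidx i' j' : (i' <= n)%N -> (j' <= n)%N -> k * v i' = l * v j' -> i' = j'.
    move=> i'n j'n eq; case: (ltngtP i' j') => // lt.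
      case: (shortest i' j' (l^-1 * k)) => //; rewrite ?divK //.
      by rewrite -mulgA eq mulKg.
    case: (shortest j' i' (k^-1 * l)) => //; rewrite ?divK //.
    by rewrite -mulgA -eq mulKg.
  have : k * v i \in [fset l * v j; l * v j.+1]%fset by rewrite -eF !inE eqxx.
  have : k * v i.+1 \in [fset l * v j; l * v j.+1]%fset by rewrite -eF !inE eqxx orbT.
  (* A common vertex has the same index in both translates, and cancelling it gives [k = l]. An edge
     shared in the reverse direction would need both [i.+1 = j] and [i = j.+1]. *)
  rewrite !inE => /orP[]/eqP e1 /orP[]/eqP e2.
  - by have := sameidx _ _ (ltnW lt_in) (ltnW lt_jn) e2 => ij; move: e2; rewrite ij => /mulIg.
  - have := sameidx _ _ lt_in (ltnW lt_jn) e1; have := sameidx _ _ (ltnW lt_in) lt_jn e2.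
    by move=> -> /eqP; rewrite eqn_leq ltnNge leqnSn.
  - by have := sameidx _ _ (ltnW lt_in) (ltnW lt_jn) e2 => ij; move: e2; rewrite ij => /mulIg.
  - by have := sameidx _ _ lt_in lt_jn e1 => -[ij]; move: e1; rewrite ij => /mulIg.
move=> _ /mapP[k kK ->]; rewrite /e insubT.
by have [] := fP (Sub k kK).
Qed.
End Inseparable.

(** As [K] commutes with [t], the points [k * t ^+ n] equal [t ^+ n * k] and are joined off [F] to
    the ray of [t] for large [n]; the same holds for the inverse. So all translates by [K] of one
    point lie in the component of each end, as [separating_edges] requires. *)
Lemma not_accessible (Gamma : groupType) :
  (forall n, exists (K : seq Gamma) (t : Gamma) (B : Gamma -> bool),
    [/\ uniq K, (n < size K)%N,
        forall k l, k \in K -> l \in K -> k^-1 * l \in K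
      & forall k, k \in K -> commute k t] /\
    [/\ almost_invariant B, forall n, B (t ^+ n.+1) & forall n, ~~ B (t ^- n.+1)]) ->
  ~ group_accessible Gamma.
Proof.
move=> large [S gen [n acc]].
have [K [t [B [[uK szK divK commK] [aB tB tnB]]]]] := large n.
have inj : injective (fun n => t ^+ n) by exact: expg_injective tB tnB.
have inj' : injective (fun n => t^-1 ^+ n).
  by move=> i j /=; rewrite !expVgn => /invg_inj /inj.
have [r [P rP]] := power_ray gen inj.
have [r' [P' rP']] := power_ray gen inj'.
have evB := power_ray_eventually (b := true) aB inj tB rP.
have evB' : exists K, forall k, (K <= k)%N -> B (r' k) = false.
  apply: power_ray_eventually aB inj' _ rP' => m.
  by rewrite expVgn; apply/negbTE.
pose w (r : ray (Cay S)) := [set r' | ray_equiv r r']%classic.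
have wne : w r <> w r'.
  move=> e; have : w r' r by rewrite -e; exact: ray_equiv_refl.
  exact: power_ends_differ.
have [F [_ Fn [x [y [xw yw nxy]]]]] := acc (w r) (w r')
  (ex_intro _ r erefl) (ex_intro _ r' erefl) wne.
have near (s : Gamma) (rs : ray (Cay S)) (Q : seq Gamma) (z : Gamma) :
    injective (fun n => s ^+ n) -> (forall k, k \in K -> commute k s) ->
    (forall N, exists K, forall k, (K <= k)%N ->
      exists n q, [/\ (N <= n)%N, q \in Q & rs k = s ^+ n * q]) ->
    end_lives_in F (w rs) z ->
    exists a, forall k, k \in K -> same_component_minus (Cay S) F z (k * a).
  move=> sinj scomm rsP zw; have [N0 N0P] := zw rs (ray_equiv_refl rs).
  have [N NP] : exists N, forall n q k, (N <= n)%N -> q \in Q -> k \in K ->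
      same_component_minus (Cay S) F (s ^+ n * q) (s ^+ n * k).
    have [Q' eQ'] : exists Q', Q' = [seq (q, k) | q <- Q, k <- K] by eexists.
    have [N NP] : exists N, forall n q, (N <= n)%N -> q \in Q' ->
        same_component_minus (Cay S) F (s ^+ n * q.1) (s ^+ n * q.2).
      elim: Q' {eQ'} => [|q Q' [N NP]]; first by exists 0.
      have [M MP] := far_connected gen F q.1 q.2 sinj.
      exists (maxn N M) => m q'; rewrite geq_max => /andP[Nm Mm].
      by rewrite inE => /predU1P[->|]; [exact: MP|exact: NP].
    exists N => m q k Nm qQ kK; apply: (NP m (q, k)) => //.
    by rewrite eQ'; apply/allpairsP; exists (q, k).
  have [L LP] := rsP N.
  have [m [q [Nm qQ rq]]] := LP (maxn L N0) (leq_maxl _ _).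
  exists (s ^+ m) => k kK.
  have -> : k * s ^+ m = s ^+ m * k by apply: commuteX; exact: scomm.
  apply: same_component_trans (NP m q k Nm qQ kK).
  by rewrite -rq; apply: N0P; exact: leq_maxr.
have [a aP] := near _ _ _ _ inj commK rP xw.
have [b bP] : exists b, forall k, k \in K -> same_component_minus (Cay S) F y (k * b).
  by apply: near inj' _ rP' yw => k /commK kt; apply: commuteV.
have K0 : exists k, k \in K by case: (K) szK => // k ? _; exists k; exact: mem_head.
have := separating_edges gen uK divK K0 aP bP nxy.
by rewrite leqNgt (leq_ltn_trans Fn szK).
Qed.

(** * Free product and semidirect product *)

Definition syllable := (int * klein)%type.

Definition top_index (l : seq syllable) : option int := omap fst (ohead l).

(* The last syllable of a normal form is the head of the list. *)
Fixpoint reduced (l : seq syllable) : bool :=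
  if l is s :: l' then [&& s.2 != 1, top_index l' != Some s.1 & reduced l'] else true.

Definition push (l : seq syllable) (c : int) (n : klein) : seq syllable :=
  if n == 1 then l else (c, n) :: l.

Definition pop (c : int) (l : seq syllable) : seq syllable * klein :=
  if l is s :: l' then if s.1 == c then (l', s.2) else (l, 1) else (l, 1).

(** Van der Waerden's method: [pop] and [push] match reduced words with pairs of a reduced word not
    ending in copy [c] and an element of that copy, and the element is multiplied on the right.
    Associativity of [join] then reduces to [appendM]. *)
Definition append (l : seq syllable) (c : int) (n : klein) : seq syllable :=
  push (pop c l).1 c ((pop c l).2 * n).

Lemma push1 l c : push l c 1 = l.
Proof. by rewrite /push eqxx. Qed.

Lemma pop_push l c n : top_index l != Some c -> pop c (push l c n) = (l, n).
Proof.
move=> lc; rewrite /push; case: (eqVneq n 1) => [->|_]; last by rewrite /= eqxx.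
case: l lc => //= -[c' n'] l; rewrite /top_index /= => ne.
by case: eqP => // e; rewrite e eqxx in ne.
Qed.

Lemma push_pop l c : push (pop c l).1 c (pop c l).2 = l \/ ~~ reduced l.
Proof.
case: l => [|[c' n'] l] /=; first by left; rewrite push1.
case: (eqVneq c' c) => [->|_] /=; last by left; rewrite push1.
by rewrite /push; case: (eqVneq n' 1) => /=; [right|left].
Qed.

Lemma push_popE l c : reduced l -> push (pop c l).1 c (pop c l).2 = l.
Proof. by move=> rl; case: (push_pop l c); rewrite ?rl. Qed.

Lemma reduced_pop l c : reduced l ->
  reduced (pop c l).1 /\ top_index (pop c l).1 != Some c.
Proof.
case: l => [|[c' n'] l] //= /and3P[n1 t r].
case: (eqVneq c' c) => [<-|ne] //=; split; first by rewrite n1 t r.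
by apply: contra ne => /eqP[->].
Qed.

Lemma reduced_push l c n : reduced l -> top_index l != Some c -> reduced (push l c n).
Proof. by rewrite /push => rl t; case: eqP => //= /eqP n1; rewrite n1 t rl. Qed.

Lemma reduced_append l c n : reduced l -> reduced (append l c n).
Proof. by move=> /(@reduced_pop _ c)[r t]; apply: reduced_push. Qed.

Lemma append_push l c n n' : top_index l != Some c ->
  append (push l c n) c n' = push l c (n * n').
Proof. by move=> t; rewrite /append pop_push. Qed.

Lemma append_top l c n : top_index l != Some c -> append l c n = push l c n.
Proof. by move=> t; rewrite -{1}(push1 l c) append_push // mul1g. Qed.

Lemma appendM l c n n' : reduced l -> append (append l c n) c n' = append l c (n * n').
Proof.
by move=> /(@reduced_pop _ c)[r t]; rewrite {1 2 3}/append pop_push //= mulgA.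
Qed.

Lemma append1 l c : reduced l -> append l c 1 = l.
Proof. by move=> r; rewrite /append mulg1 push_popE. Qed.

Definition join (l1 l2 : seq syllable) : seq syllable :=
  foldr (fun s l => append l s.1 s.2) l1 l2.

Lemma reduced_join l1 l2 : reduced l1 -> reduced (join l1 l2).
Proof. by move=> r1; elim: l2 => //= s l2 IH; apply: reduced_append. Qed.

Lemma join_push l1 l c n : reduced l1 -> join l1 (push l c n) = append (join l1 l) c n.
Proof.
move=> r1; rewrite /push; case: eqP => // ->.
by rewrite append1 //; exact: reduced_join.
Qed.

Lemma join_append l1 l c n : reduced l1 -> reduced l ->
  join l1 (append l c n) = append (join l1 l) c n.
Proof.
move=> r1 rl; rewrite {1}/append join_push // -appendM ?reduced_join //.
by rewrite -join_push // push_popE.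
Qed.

Lemma joinA l1 l2 l3 : reduced l1 -> reduced l2 ->
  join l1 (join l2 l3) = join (join l1 l2) l3.
Proof.
move=> r1 r2; elim: l3 => //= s l3 IH; rewrite join_append ?IH //.
exact: reduced_join.
Qed.

Lemma join1 l : reduced l -> join [::] l = l.
Proof.
elim: l => //= -[c n] l IH /= /and3P[n1 t r].
by rewrite IH // append_top // /push (negbTE n1).
Qed.

Definition inverse (l : seq syllable) : seq syllable :=
  foldr (fun s l' => join [:: (s.1, s.2^-1)] l') [::] l.

Lemma reduced1 c n : n != 1 -> reduced [:: (c, n)].
Proof. by rewrite /= => ->. Qed.

Lemma reduced_inverse l : reduced l -> reduced (inverse l).
Proof.
case: l => //= -[c n] l /and3P[n1 _ _]; apply: reduced_join.
by apply: reduced1; rewrite /= invg_eq1.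
Qed.

Lemma append_single c n n' : append [:: (c, n)] c n' = push [::] c (n * n').
Proof. by rewrite /append /= eqxx. Qed.

Lemma inverseK l : reduced l -> join (inverse l) l = [::].
Proof.
elim: l => //= -[c n] l IH /= /and3P[n1 t r].
have r' : reduced [:: (c, n^-1)] by apply: reduced1; rewrite invg_eq1.
by rewrite -joinA ?reduced_inverse // IH // append_single mulVg push1.
Qed.

Lemma inverseKr l : reduced l -> join l (inverse l) = [::].
Proof.
elim: l => //= -[c n] l IH /= /and3P[n1 t r].
have r' : reduced [:: (c, n^-1)] by apply: reduced1; rewrite invg_eq1.
rewrite joinA //= ?n1 ?t //; rewrite [append _ _ _](_ : _ = l) ?IH //.
by rewrite /append /= eqxx mulgV push1.
Qed.

Definition free_product := {l : seq syllable | reduced l}.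
HB.instance Definition _ := Choice.on free_product.

Definition fmul (m m' : free_product) : free_product :=
  exist reduced (join (val m) (val m')) (reduced_join (val m') (valP m)).
Definition fone : free_product := exist reduced [::] isT.
Definition finv (m : free_product) : free_product :=
  exist reduced (inverse (val m)) (reduced_inverse (valP m)).

Fact fmulA : associative fmul.
Proof. by move=> l1 l2 l3; apply: val_inj; rewrite /= joinA ?(valP l1) ?(valP l2). Qed.
Fact fmul1 : left_id fone fmul.
Proof. by move=> l; apply: val_inj; rewrite /= join1 ?(valP l). Qed.
Fact fmul1r : right_id fone fmul.
Proof. by move=> l; apply: val_inj. Qed.
Fact fmulV : left_inverse fone finv fmul.
Proof. by move=> l; apply: val_inj; rewrite /= inverseK ?(valP l). Qed.
Fact fmulVr : right_inverse fone finv fmul.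
Proof. by move=> l; apply: val_inj; rewrite /= inverseKr ?(valP l). Qed.

HB.instance Definition _ := isGroup.Build free_product fmulA fmul1 fmul1r fmulV fmulVr.

(** * The lamplighter group and its action on the free product *)

Definition lamplighter := (int * lamps)%type.
HB.instance Definition _ := Choice.on lamplighter.

(* (i, f) stands for t^i f. *)
Definition hmul (h k : lamplighter) : lamplighter :=
  ((h.1 + k.1)%R, shift k.1 h.2 :+: k.2).
Definition hone : lamplighter := (0%R, fset0).
Definition hinv (h : lamplighter) : lamplighter := ((- h.1)%R, shift (- h.1)%R h.2).

Fact hmulA : associative hmul.
Proof.
move=> [i f] [j g] [k e]; rewrite /hmul /= GRing.addrA shift_lxor shiftD lxorA.
by rewrite (GRing.addrC k).
Qed.
Fact hmul1 : left_id hone hmul.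
Proof. by move=> [i f]; rewrite /hmul /= GRing.add0r shift_fset0 lxor0l. Qed.
Fact hmul1r : right_id hone hmul.
Proof. by move=> [i f]; rewrite /hmul /= GRing.addr0 shift0 lxor0. Qed.
Fact hmulV : left_inverse hone hinv hmul.
Proof.
by move=> [i f]; rewrite /hmul /= GRing.addNr shiftD GRing.addrN shift0 lxorxx.
Qed.
Fact hmulVr : right_inverse hone hinv hmul.
Proof. by move=> [i f]; rewrite /hmul /= GRing.addrN lxorxx. Qed.

HB.instance Definition _ := isGroup.Build lamplighter hmulA hmul1 hmul1r hmulV hmulVr.

Section Twist.
Variable h : lamplighter.

(** Copy c is the conjugate of copy 0 by t^c, and f t^c = t^c ([shift c f]); this is why the lamps
    reach copy c shifted by c. *)
Definition twist_syllable (s : syllable) : syllable :=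
  ((s.1 + h.1)%R, translate (shift s.1 h.2) s.2).

Lemma twist_top l c : (top_index (map twist_syllable l) == Some (c + h.1)%R) =
  (top_index l == Some c).
Proof.
by case: l => //= s l; rewrite /top_index /= !(inj_eq Some_inj) (inj_eq (GRing.addIr _)).
Qed.

Lemma reduced_twist l : reduced l -> reduced (map twist_syllable l).
Proof.
elim: l => //= s l IH /and3P[n1 t r].
by rewrite twist_top t IH // translate_eq1 n1.
Qed.

Lemma twist_append l c n : map twist_syllable (append l c n) =
  append (map twist_syllable l) (c + h.1)%R (translate (shift c h.2) n).
Proof.
have twist_push l' n' : map twist_syllable (push l' c n') =
    push (map twist_syllable l') (c + h.1)%R (translate (shift c h.2) n').
  by rewrite /push translate_eq1; case: ifP.
rewrite /append twist_push; case: l => [|[c' n'] l] /=.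
  by rewrite translateM translate1.
rewrite (inj_eq (GRing.addIr _)); case: eqP => [->|_] /=.
  by rewrite translateM.
by rewrite translateM translate1.
Qed.

Definition twist (m : free_product) : free_product :=
  exist reduced (map twist_syllable (val m)) (reduced_twist (valP m)).

Lemma twistM m m' : twist (m * m') = twist m * twist m'.
Proof.
apply: val_inj => /=; elim: (val m') => //= s l IH.
by rewrite twist_append IH.
Qed.

Lemma twist1 : twist 1 = 1.
Proof. exact: val_inj. Qed.
End Twist.

Lemma twistD h k m : twist (h * k) m = twist h (twist k m).
Proof.
apply: val_inj => /=; rewrite -map_comp; apply: eq_map => -[c n] /=.
rewrite /twist_syllable /= -GRing.addrA (GRing.addrC h.1) -translateD.
by rewrite shift_lxor shiftD.
Qed.

Lemma twist_id m : twist 1 m = m.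
Proof.
apply: val_inj => /=; rewrite -[RHS]map_id; apply: eq_map => -[c n].
by rewrite /twist_syllable /= GRing.addr0 shift_fset0 translate0.
Qed.

Definition Gam := (free_product * lamplighter)%type.
HB.instance Definition _ := Choice.on Gam.

Definition gmul (x y : Gam) : Gam := (x.1 * twist x.2 y.1, x.2 * y.2).
Definition gone : Gam := (1, 1).
Definition ginv (x : Gam) : Gam := (twist x.2^-1 x.1^-1, x.2^-1).

Fact gmulA : associative gmul.
Proof. by move=> x y w; rewrite /gmul /= twistM twistD !mulgA. Qed.
Fact gmul1 : left_id gone gmul.
Proof. by move=> [m h]; rewrite /gmul /= twist_id !mul1g. Qed.
Fact gmul1r : right_id gone gmul.
Proof. by move=> [m h]; rewrite /gmul /= twist1 !mulg1. Qed.
Fact gmulV : left_inverse gone ginv gmul.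
Proof. by move=> [m h]; rewrite /gmul /= -twistM !mulVg twist1. Qed.
Fact gmulVr : right_inverse gone ginv gmul.
Proof. by move=> [m h]; rewrite /gmul /= -twistD !mulgV twist_id mulgV. Qed.

HB.instance Definition _ := isGroup.Build Gam gmulA gmul1 gmul1r gmulV gmulVr.

(** * Inaccessibility *)

Definition single (c : int) (n : klein) : free_product :=
  exist reduced (append [::] c n) (reduced_append c n (isT : reduced [::])).

Definition gen_t : Gam := (1, (1%R, fset0)).
Definition gen_a : Gam := (1, (0%R, bit 0)).
Definition gen_z : Gam := (single 0%R (z 0 fset0), 1).

Lemma val_fmul (m m' : free_product) : val (m * m') = join (val m) (val m').
Proof. by []. Qed.

Lemma val_single c n : val (single c n) = append [::] c n.
Proof. by []. Qed.

Lemma singleM c n n' : single c (n * n') = single c n * single c n'.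
Proof.
apply: val_inj; rewrite val_fmul !val_single join_append ?reduced_append //.
by rewrite [join _ [::]]/= appendM.
Qed.

Lemma single1 c : single c 1 = 1.
Proof. by apply: val_inj; rewrite val_single append1. Qed.

Lemma mul_single (m : free_product) c n : val (m * single c n) = append (val m) c n.
Proof. by rewrite val_fmul val_single join_append ?(valP m). Qed.

Lemma twist_single h c n :
  twist h (single c n) = single (c + h.1)%R (translate (shift c h.2) n).
Proof. by apply: val_inj; exact: twist_append. Qed.

Lemma Gam_mulE (x y : Gam) : x * y = (x.1 * twist x.2 y.1, x.2 * y.2).
Proof. by []. Qed.

Lemma hmulE (h k : lamplighter) : h * k = ((h.1 + k.1)%R, shift k.1 h.2 :+: k.2).
Proof. by []. Qed.

Lemma mul_t (x : Gam) : x * gen_t = (x.1, ((x.2.1 + 1)%R, shift 1%R x.2.2)).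
Proof.
case: x => m [i f]; rewrite Gam_mulE /= twist1 mulg1; congr pair.
by rewrite hmulE /= lxor0.
Qed.

Lemma mul_a (x : Gam) : x * gen_a = (x.1, (x.2.1, x.2.2 :+: bit 0)).
Proof.
case: x => m [i f]; rewrite Gam_mulE /= twist1 mulg1; congr pair.
by rewrite hmulE /= shift0 GRing.addr0.
Qed.

(** The state of the lamplighter selects the copy and the leaf, so that conjugates of the single
    [gen_z] supply all generators of all copies. *)
Lemma mul_z (x : Gam) : x * gen_z = (x.1 * single x.2.1 (z 0 x.2.2), x.2).
Proof.
case: x => m [i f]; rewrite Gam_mulE /= mulg1 twist_single /= GRing.add0r.
by rewrite translate_z shift0 lxor0.
Qed.

Definition of_lamp (h : lamplighter) : Gam := (1, h).
Definition of_free (m : free_product) : Gam := (m, 1).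

Lemma of_lampM h k : of_lamp (h * k) = of_lamp h * of_lamp k.
Proof. by rewrite Gam_mulE /= twist1 mulg1. Qed.

Lemma of_freeM m m' : of_free (m * m') = of_free m * of_free m'.
Proof. by rewrite Gam_mulE /= twist_id mulg1. Qed.

Lemma of_free_lamp (x : Gam) : x = of_free x.1 * of_lamp x.2.
Proof. by case: x => m h; rewrite Gam_mulE /= twist1 mulg1 mul1g. Qed.

Lemma of_lampV h : of_lamp h^-1 = (of_lamp h)^-1.
Proof. by apply: (mulgI (of_lamp h)); rewrite -of_lampM !mulgV. Qed.

Definition gens : {fset Gam} := [fset gen_t; gen_a; gen_z].

Section Generation.
Let letter (x : Gam) := (x \in gens) || (x^-1 \in gens).
Let made (g : Gam) := exists2 w : seq Gam, all letter w & g = \prod_(x <- w) x.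

Let madeM g h : made g -> made h -> made (g * h).
Proof.
by move=> [w ww ->] [v vv ->]; exists (w ++ v); rewrite ?all_cat ?ww ?big_cat.
Qed.

Let madeV g : made g -> made g^-1.
Proof.
move=> [w + ->]; elim: w => [_|x w IH /= /andP[lx lw]].
  by exists [::]; rewrite // big_nil invg1.
rewrite big_cons invgM; apply: madeM; first exact: IH.
by exists [:: x^-1]; rewrite ?big_seq1 //= andbT /letter invgK orbC.
Qed.

Let made_gen g : g \in gens -> made g.
Proof. by move=> gg; exists [:: g]; rewrite ?big_seq1 //= /letter gg. Qed.

Let made1 : made 1.
Proof. by exists [::]; rewrite // big_nil. Qed.

Let in_gens : (gen_t \in gens) /\ (gen_a \in gens) /\ (gen_z \in gens).
Proof. by rewrite !inE !eqxx !orbT. Qed.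

Let made_shift (j : int) : made (of_lamp (j, fset0)).
Proof.
have natE (n : nat) : made (of_lamp (n%:Z, fset0)%R).
  elim: n => [|n IH]; first exact: made1.
  have -> : of_lamp (n.+1%:Z, fset0)%R = of_lamp (n%:Z, fset0)%R * gen_t.
    by rewrite mul_t /= shift_fset0 -addn1 PoszD.
  exact: madeM IH (made_gen in_gens.1).
case: j => n; first exact: natE.
have -> : of_lamp (Negz n, fset0) = (of_lamp (n.+1%:Z, fset0)%R)^-1.
  by rewrite -of_lampV; congr of_lamp; transitivity (hinv (n.+1%:Z, fset0)%R) => //;
    rewrite /hinv /= shift_fset0 NegzE.
exact/madeV/natE.
Qed.

Lemma lampM (f g : lamps) : of_lamp (0%R, f :+: g) = of_lamp (0%R, f) * of_lamp (0%R, g).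
Proof. by rewrite -of_lampM hmulE /= shift0 GRing.addr0. Qed.

Let made_lamps (f : lamps) : made (of_lamp (0%R, f)).
Proof.
have one (x : int) : made (of_lamp (0%R, [fset x])).
  have -> : of_lamp (0%R, [fset x]) =
      of_lamp ((- x)%R, fset0) * gen_a * of_lamp (x, fset0).
    have -> : of_lamp ((- x)%R, fset0) * gen_a = of_lamp ((- x)%R, bit 0).
      by rewrite mul_a /= lxor0l.
    rewrite -of_lampM hmulE /= lxor0 GRing.addNr.
    congr of_lamp; congr pair; apply/fsetP => y; rewrite in_shift !inE /pos /=.
    by rewrite GRing.subr_eq0.
  by apply: madeM; [apply: madeM => //; apply: made_gen; case: in_gens => _ []|].
elim/finSet_rect: f => f IH; have [->|/fset0Pn[x xf]] := eqVneq f fset0.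
  exact: made_shift.
have -> : f = [fset x] :+: (f `\ x).
  apply/fsetP => y; rewrite in_lxor !inE.
  by case: (eqVneq y x) => [->|]; rewrite ?xf.
rewrite lampM; apply: madeM (one x) _.
by apply: IH; rewrite fproperD1.
Qed.

Let made_lamplighter (h : lamplighter) : made (of_lamp h).
Proof.
case: h => i f; have -> : (i, f) = ((i, fset0) : lamplighter) * (0%R, f) :> lamplighter.
  by rewrite hmulE /= shift_fset0 lxor0l GRing.addr0.
by rewrite of_lampM; exact: madeM.
Qed.

Let made_single c n : made (of_free (single c n)).
Proof.
elim/klein_ind: n => [|n f IH]; first by rewrite single1.
rewrite singleM of_freeM; apply: madeM IH _.
have -> : of_free (single c (z 0 f)) = of_lamp (c, f) * gen_z * (of_lamp (c, f))^-1.
  apply: (mulIg (of_lamp (c, f))); rewrite mulgVK mul_z /= mul1g.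
  by rewrite [RHS]of_free_lamp.
apply: madeM; last exact/madeV/made_lamplighter.
by apply: madeM; [exact: made_lamplighter|apply: made_gen; case: in_gens => _ []].
Qed.

Lemma generates_gens : generates gens.
Proof.
move=> x; rewrite (of_free_lamp x); apply: madeM (made_lamplighter x.2).
case: x => -[l + _] /=; elim: l => [|[c n] l IH] rl.
  suff -> : (exist reduced [::] rl : free_product) = 1 by exact: made1.
  exact: val_inj.
have r : reduced l by move: rl => /= /and3P[].
suff -> : (exist reduced ((c, n) :: l) rl : free_product) =
    (exist reduced l r : free_product) * single c n.
  by rewrite of_freeM; exact: madeM.
apply: val_inj; rewrite mul_single; move: (rl) => /= /and3P[n1 t _].
by rewrite append_top // /push (negbTE n1).
Qed.
End Generation.

Lemma almost_invariant_gens (B : Gam -> bool) :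
  (forall s, s \in gens -> exists E : seq Gam, forall g, B g != B (g * s) -> g \in E) ->
  almost_invariant B.
Proof.
move=> h s; have [w + ->] := generates_gens s.
elim: w => [|x w IH] /=; first by exists [::] => g; rewrite big_nil mulg1 eqxx.
move=> /andP[lx /IH[E EP]].
have [E' EP'] : exists E' : seq Gam, forall g, B g != B (g * x) -> g \in E'.
  case/orP: lx => /h // [E' EP']; exists [seq g * x^-1 | g <- E'] => g ne.
  by rewrite -[g](mulgK x); apply: map_f; apply: EP'; rewrite mulgK eq_sym.
exists (E' ++ [seq g * x^-1 | g <- E]) => g; rewrite big_cons mulgA mem_cat => ne.
have [e|/EP' -> //] := eqVneq (B g) (B (g * x)).
apply/orP; right; rewrite -[g](mulgK x); apply: map_f; apply: EP.
by rewrite -e.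
Qed.

Section Inaccessible.
Variable m : nat.
Let N := m.+1.

(** The first syllable of a normal form is the last of the list; the empty word counts as the
    trivial syllable of copy 0. *)
Definition far_side (x : Gam) : bool :=
  let s := last (0%R, 1) (val x.1) in (s.1 == 0%R) && beyond N s.2.

Definition window (n : nat) : {fset int} := [fset pos k | k in iota 0 n].

Lemma window_mask n (q : lamps) : (q `<=` window n) = (mask n q == fset0).
Proof.
apply/fsubsetP/eqP => [sub|e x xq].
  apply/fsetP => x; rewrite !lampE; apply/negbTE/negP => /andP[/sub].
  by move=> /imfsetP[k /=]; rewrite mem_iota => kn ->; rewrite posK; lia.
apply/imfsetP; exists (code x); last by rewrite codeK.
have /fsetP/(_ x) := e; rewrite /= mem_iota !lampE xq /= => /negbT.
by rewrite -ltnNge.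
Qed.

(** Appending acts at the end of a normal form, so it can alter the first syllable only if nothing
    remains once a final syllable of copy [c] is removed. *)
Lemma far_side_append (l : seq syllable) (c : int) (n : klein) :
  reduced l ->
  let side l := let s := last (0%R, 1) l in (s.1 == 0%R) && beyond N s.2 in
  side l != side (append l c n) ->
  [/\ c = 0%R, l = append [::] c (pop c l).2 &
      beyond N (pop c l).2 != beyond N ((pop c l).2 * n)].
Proof.
move=> rl side; rewrite -{1}(push_popE c rl) /append.
have [rl' _] := reduced_pop c rl.
case: (pop c l) (push_popE c rl) => [[|s l'] n'] /= e.
  have sideE n1 : side (push [::] c n1) = (c == 0%R) && beyond N n1.
    rewrite /side /push; case: (eqVneq n1 1) => [->|] //=.
    by rewrite beyond1 !andbF.
  rewrite !sideE; case: (eqVneq c 0%R) => //= c0 ne; split=> //.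
  by rewrite -e /append /= mul1g.
by rewrite /side /push; do 2!case: ifP => _ //=; rewrite eqxx.
Qed.

Lemma almost_invariant_far_side : almost_invariant far_side.
Proof.
apply: almost_invariant_gens => s; rewrite !inE -orbA => /or3P[]/eqP ->.
- by exists [::] => g; rewrite mul_t /far_side /= eqxx.
- by exists [::] => g; rewrite mul_a /far_side /= eqxx.
(* The finite list comes from [beyond_change]: the leaf is below the wall, so its lamps lie in
   [window N], and the syllable is in the wall group before or after multiplication by [z 0 f]. *)
exists [seq of_free (single 0%R p.1) * of_lamp (0%R, p.2) | p <-
  flatten [seq [:: (1, f); (z N fset0, f); (z 0 f, f); (z N fset0 * z 0 f, f)]
          | f <- fpowerset (window N)]].
move=> [[l rl] [i f]]; rewrite mul_z /far_side mul_single /= => ne.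
have [i0 le] := far_side_append rl ne; rewrite i0 in le *.
rewrite eq_sym => /beyond_change[uf aw].
apply/mapP; exists ((pop 0%R l).2, f); last first.
  by rewrite [LHS]of_free_lamp; congr (of_free _ * _); apply: val_inj.
apply/flatten_mapP; exists f.
  rewrite fpowersetE window_mask; move: uf; rewrite /under.
  by rewrite (_ : mask N fset0 = fset0) //; apply/fsetP => x; rewrite !lampE.
set n := (pop _ _).2 in aw *.
rewrite !inE !xpair_eqE eqxx !andbT.
have inv y : (n * z 0 f == y) = (n == y * z 0 f).
  by rewrite -(inj_eq (mulIg (z 0 f))) -mulgA zz mulg1.
by move: aw; rewrite /at_wall !inv mul1g -!orbA.
Qed.

Definition lamp_group : seq Gam :=
  [seq of_lamp (0%R, q) | q <- enum_fset (fpowerset (window m))].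

Lemma lamp_groupP (x : Gam) :
  reflect (exists2 q, mask m q = fset0 & x = of_lamp (0%R, q)) (x \in lamp_group).
Proof.
apply: (iffP mapP) => -[q qP ->]; exists q => //.
  by apply/eqP; rewrite -window_mask -fpowersetE.
by rewrite fpowersetE window_mask qP eqxx.
Qed.

Lemma card_lamp_group : (m < size lamp_group)%N.
Proof.
rewrite size_map -[size _]/(#|` fpowerset (window m)|) card_fpowerset.
rewrite card_imfset /=; last exact: can_inj posK.
by rewrite undup_id ?iota_uniq // size_iota ltn_expl.
Qed.

Lemma uniq_lamp_group : uniq lamp_group.
Proof. by rewrite map_inj_uniq ?fset_uniq // => p q [->]. Qed.

Lemma lamp_group_div k l : k \in lamp_group -> l \in lamp_group -> k^-1 * l \in lamp_group.
Proof.
move=> /lamp_groupP[p p0 ->] /lamp_groupP[q q0 ->]; apply/lamp_groupP.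
exists (p :+: q); first by rewrite mask_lxor p0 q0 lxor0.
by apply: (mulgI (of_lamp (0%R, p))); rewrite mulVKg -lampM lxorKl.
Qed.

Definition axis : Gam := of_free (single 0%R (shear m)).

Lemma lamp_group_commute k : k \in lamp_group -> commute k axis.
Proof.
move=> /lamp_groupP[q q0 ->]; rewrite /commute !Gam_mulE /= twist1 !mul1g !mulg1.
by rewrite twist_single /= shift0 translate_shear.
Qed.

Lemma axisX i : axis ^+ i = of_free (single 0%R (shear m ^+ i)).
Proof.
elim: i => [|i IH]; first by rewrite !expg0 single1.
by rewrite !expgSr IH singleM of_freeM.
Qed.

Lemma axisV i : axis ^- i = of_free (single 0%R (shear m ^- i)).
Proof.
apply: (mulgI (axis ^+ i)); rewrite mulgV axisX -of_freeM.
by rewrite -singleM mulgV single1.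
Qed.

Lemma far_side_single n : far_side (of_free (single 0%R n)) = beyond N n.
Proof.
rewrite /far_side /= append_top // /push.
by case: (eqVneq n 1) => [->|_] /=; rewrite ?eqxx.
Qed.
End Inaccessible.

Lemma Gam_not_accessible : ~ group_accessible Gam.
Proof.
apply: not_accessible => m; exists (lamp_group m), (axis m), (far_side m); split; split.
- exact: uniq_lamp_group.
- exact: card_lamp_group.
- exact: lamp_group_div.
- exact: lamp_group_commute.
- exact: almost_invariant_far_side.
- by move=> n; rewrite axisX far_side_single; exact: beyond_shear.
- by move=> n; rewrite axisV far_side_single; rewrite beyond_shearV.
Qed.

(** * Words of tree edges *)

Definition node := (nat * lamps)%type.
Definition sheet := (lamps -> bool).
Definition letter := (node * sheet)%type.

Definition above (v : node) : node := (v.1.+1, mask v.1.+1 v.2).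

Definition leaves (b : node) : sheet := under b.1 b.2.
Definition sheet_add (alpha beta : sheet) : sheet := fun g => alpha g (+) beta g.
Definition sheet0 : sheet := fun=> false.

Lemma sheet_addK alpha beta : sheet_add (sheet_add alpha beta) beta = alpha.
Proof. by apply/funext => g; rewrite /sheet_add -addbA addbb addbF. Qed.

(* The edge from b to its parent in the sheet alpha of the quotient of the
   Bass-Serre tree by the kernel of ab; the translate of the sheet by z_b shares it. *)
Definition edge (b : node) (alpha : sheet) : letter :=
  (b, if alpha (mask b.1 b.2) then sheet_add alpha (leaves b) else alpha).

Lemma edge_add b alpha : edge b (sheet_add alpha (leaves b)) = edge b alpha.
Proof.
rewrite /edge sheet_addK {1}/sheet_add {1}/leaves /under mask_id eqxx addbT.
by case: (alpha _).
Qed.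

Lemma edge_inj b alpha b' alpha' : edge b alpha = edge b' alpha' ->
  b = b' /\ (alpha' = alpha \/ alpha' = sheet_add alpha (leaves b)).
Proof.
case=> -> /esym; case: ifP => _; case: ifP => _ e; split=> //.
- left; by rewrite -[LHS](sheet_addK _ (leaves b')) e sheet_addK.
- by right; rewrite -e sheet_addK.
- by right.
- by left.
Qed.

Lemma edge0 b : edge b sheet0 = (b, sheet0).
Proof. by []. Qed.

Section Star.
Variable T : eqType.

Fixpoint wreduced (l : seq T) : bool :=
  if l is e :: l' then (ohead l' != Some e) && wreduced l' else true.

(** Letters are unoriented edges, so going back along an edge repeats its letter: words reduce as in
    a free product of groups of order 2. *)
Definition star (l : seq T) (e : T) : seq T :=
  if l is e' :: l' then if e' == e then l' else e :: l else [:: e].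

Lemma wreduced_star l e : wreduced l -> wreduced (star l e).
Proof.
case: l => //= e' l /andP[h r]; case: ifP => //= ne.
by rewrite (inj_eq Some_inj) ne h r.
Qed.

Lemma starK l e : wreduced l -> star (star l e) e = l.
Proof.
case: l => [|e' l] /=; first by rewrite eqxx.
case: (eqVneq e' e) => [->|ne] /=; last by rewrite eqxx.
by case: l => //= e'' l; rewrite ?(inj_eq Some_inj) => /andP[/negbTE ->].
Qed.

Lemma star_cons l e : wreduced (e :: l) -> star l e = e :: l.
Proof.
by case: l => //= e' l; rewrite ?(inj_eq Some_inj) => /andP[/negbTE ->].
Qed.

Lemma star_cases l e : star l e = e :: l \/ l = e :: star l e.
Proof. by case: l => [|e' l] /=; [left|case: eqP => [->|_]; [right|left]]. Qed.

Definition stars (l : seq T) (p : seq T) : seq T := foldl star l p.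

Lemma stars_cat l p q : stars l (p ++ q) = stars (stars l p) q.
Proof. exact: foldl_cat. Qed.

Lemma wreduced_stars l p : wreduced l -> wreduced (stars l p).
Proof. by elim: p l => //= e p IH l r; apply/IH/wreduced_star. Qed.

Lemma stars_revK l p : wreduced l -> stars (stars l p) (rev p) = l.
Proof.
elim: p l => //= e p IH l r; rewrite rev_cons -cats1 stars_cat IH ?wreduced_star //.
exact: starK.
Qed.
End Star.

Definition climb (L n : nat) (f : lamps) : seq node :=
  [seq (k, fset0) | k <- iota 0 L] ++ rev [seq (k, mask k f) | k <- iota n (L - n)].

Definition route (L n : nat) (f : lamps) (alpha : sheet) : seq letter :=
  [seq edge b alpha | b <- climb L n f].

Definition height (n : nat) (f : lamps) : nat :=
  maxn n (projT1 (cid (mask_eventually f))).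

Lemma height_ge n f : (n <= height n f)%N.
Proof. exact: leq_maxl. Qed.

Lemma mask_height n f k : (height n f <= k)%N -> mask k f = fset0.
Proof.
by rewrite /height geq_max => /andP[_]; case: cid => L LP /=; exact: LP.
Qed.

Definition walk (alpha : sheet) (n : nat) (f : lamps) (l : seq letter) : seq letter :=
  stars l (route (height n f) n f alpha).

Definition unwalk (alpha : sheet) (n : nat) (f : lamps) (l : seq letter) : seq letter :=
  stars l (rev (route (height n f) n f alpha)).

Lemma climb_recr L n f : (n <= L)%N -> climb L.+1 n f =
  [seq (k, fset0) | k <- iota 0 L] ++ (L, fset0) :: (L, mask L f) ::
  rev [seq (k, mask k f) | k <- iota n (L - n)].
Proof.
move=> nL; rewrite /climb -addn1 iotaD map_cat /= add0n -catA /=; congr (_ ++ _ :: _).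
rewrite -addnBAC // iotaD map_cat rev_cat /= subnKC //.
Qed.

(** Above the level where the configuration is masked to [fset0], ascent and descent use the same
    edges, whose letters cancel. So the height chosen in [walk] is immaterial. *)
Lemma route_indep alpha n f g L L' l : wreduced l -> (n <= L)%N -> (n <= L')%N ->
  mask n f = mask n g ->
  (forall k, (L <= k)%N -> mask k f = fset0) ->
  (forall k, (L' <= k)%N -> mask k g = fset0) ->
  stars l (route L n f alpha) = stars l (route L' n g alpha) /\
  stars l (rev (route L n f alpha)) = stars l (rev (route L' n g alpha)).
Proof.
move=> r nL nL' fg fL gL'.
have mfg k : (n <= k)%N -> mask k f = mask k g.
  by move=> nk; rewrite -(maxn_idPl nk) -!mask_mask fg.
have same M : route M n f alpha = route M n g alpha.
  congr map; congr (_ ++ rev _); apply/eq_in_map => k; rewrite mem_iota => /andP[nk _].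
  by rewrite mfg.
have grow M d : (n <= M)%N -> (forall k, (M <= k)%N -> mask k g = fset0) ->
    stars l (route (M + d) n g alpha) = stars l (route M n g alpha) /\
    stars l (rev (route (M + d) n g alpha)) = stars l (rev (route M n g alpha)).
  move=> nM gM; elim: d => [|d [IH1 IH2]]; first by rewrite addn0.
  rewrite -IH1 -IH2 addnS /route climb_recr ?(leq_trans nM) ?leq_addr //.
  rewrite gM ?leq_addr // /climb !map_cat /=; set p := map _ _; set q := map _ (rev _).
  split; first by rewrite !stars_cat /= starK // wreduced_stars.
  rewrite !rev_cat !rev_cons -!cats1 -!catA !stars_cat /= starK // wreduced_stars //.
rewrite same; have gL k (Lk : (L <= k)%N) := etrans (esym (mfg k (leq_trans nL Lk))) (fL k Lk).
have [h1 h2] := grow L L' nL gL.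
have [h3 h4] := grow L' L nL' gL'.
by rewrite -h1 -h2 -h3 -h4 addnC.
Qed.

Lemma walkE alpha n f L l : wreduced l -> (n <= L)%N ->
  (forall k, (L <= k)%N -> mask k f = fset0) ->
  walk alpha n f l = stars l (route L n f alpha) /\
  unwalk alpha n f l = stars l (rev (route L n f alpha)).
Proof.
move=> r nL fL; apply: route_indep => //; first exact: height_ge.
exact: mask_height.
Qed.

Lemma walk_mask alpha n f g l : wreduced l -> mask n f = mask n g ->
  walk alpha n f l = walk alpha n g l /\ unwalk alpha n f l = unwalk alpha n g l.
Proof.
move=> r fg; apply: route_indep => //; rewrite ?height_ge //.
- exact: mask_height.
- exact: mask_height.
Qed.

Lemma wreduced_walk alpha n f l : wreduced l -> wreduced (walk alpha n f l).
Proof. exact: wreduced_stars. Qed.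

Lemma wreduced_unwalk alpha n f l : wreduced l -> wreduced (unwalk alpha n f l).
Proof. exact: wreduced_stars. Qed.

Lemma walkK alpha n f l : wreduced l -> unwalk alpha n f (walk alpha n f l) = l.
Proof. exact: stars_revK. Qed.

Lemma unwalkK alpha n f l : wreduced l -> walk alpha n f (unwalk alpha n f l) = l.
Proof. by move=> r; rewrite /walk -{1}[route _ _ _ _]revK stars_revK. Qed.

Lemma route_rec alpha n f L : (n < L)%N ->
  route L n f alpha = rcons (route L n.+1 f alpha) (edge (n, mask n f) alpha).
Proof.
move=> nL; rewrite /route -map_rcons; congr map.
rewrite /climb -cats1 -catA; congr (_ ++ _).
by rewrite -(subnSK nL) /= rev_cons cats1.
Qed.

Lemma walkS alpha n f l : wreduced l ->
  walk alpha n f l = star (walk alpha n.+1 f l) (edge (n, mask n f) alpha) /\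
  unwalk alpha n f l = unwalk alpha n.+1 f (star l (edge (n, mask n f) alpha)).
Proof.
move=> r.
have [L [nL fL]] : exists L, (n < L)%N /\ forall k, (L <= k)%N -> mask k f = fset0.
  by exists (height n.+1 f); split; [exact: height_ge|exact: mask_height].
have [-> ->] := walkE alpha r (ltnW nL) fL.
have [-> _] := walkE alpha r nL fL.
have [_ ->] := walkE alpha (wreduced_star (edge (n, mask n f) alpha) r) nL fL.
by rewrite route_rec // rev_rcons -cats1 stars_cat.
Qed.

Definition position := ({l : seq letter | wreduced l} * sheet)%type.

(** [z n f] fixes the vertex of the node, where the old and the new sheet meet: one walks there in
    the old sheet and returns in the new one. *)
Definition hop (n : nat) (f : lamps) (s : position) : position :=
  (exist (@wreduced _)
     (unwalk (sheet_add s.2 (under n f)) n f (walk s.2 n f (val s.1)))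
     (wreduced_unwalk _ _ _ (wreduced_walk _ _ _ (valP s.1))),
   sheet_add s.2 (under n f)).

Lemma position_eq (s t : position) : val s.1 = val t.1 -> s.2 = t.2 -> s = t.
Proof. by case: s t => [l a] [l' a'] /= /val_inj -> ->. Qed.

Lemma hopK n f s : hop n f (hop n f s) = s.
Proof.
apply: position_eq => /=; last exact: sheet_addK.
by rewrite sheet_addK unwalkK ?walkK ?wreduced_walk ?(valP s.1).
Qed.

Lemma underS_add n f : under n.+1 f = sheet_add (under n f) (under n (f :+: bit n)).
Proof. by apply/funext => g; rewrite underS. Qed.

Lemma hop_mask n f g s : mask n f = mask n g -> hop n f s = hop n g s.
Proof.
move=> fg; have e : under n f = under n g by apply/funext => h; rewrite /under fg.
apply: position_eq => /=; rewrite e //.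
have [-> _] := walk_mask s.2 (valP s.1) fg.
by have [_ ->] := walk_mask (sheet_add s.2 (under n g)) (wreduced_walk s.2 n g (valP s.1)) fg.
Qed.

(** The edge above a node is one letter for both sheets ([edge_add]), so each hop can be made one
    level higher, and between the two hops the return and the new walk cancel. Since the result
    depends only on the parent, the sibling relation follows. *)
Lemma hopS n f s : hop n.+1 f s = hop n (f :+: bit n) (hop n f s).
Proof.
have sib : mask n.+1 (f :+: bit n) = mask n.+1 f := mask_sibling n f.
have addA a b c : sheet_add (sheet_add a b) c = sheet_add a (sheet_add b c).
  by apply/funext => g; rewrite /sheet_add addbA.
apply: position_eq => /=; last by rewrite addA -underS_add.
case: s => -[l r] alpha /=; rewrite underS_add -addA.
set a1 := sheet_add alpha (under n f); set a2 := sheet_add a1 _.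
set l1 := walk alpha n.+1 f l.
have r1 : wreduced l1 by exact: wreduced_walk.
have edge1 : edge (n, mask n f) a1 = edge (n, mask n f) alpha.
  rewrite -[RHS]edge_add; congr edge; apply/funext => g.
  by rewrite /a1 /sheet_add /leaves /under /= mask_id.
have edge2 : edge (n, mask n (f :+: bit n)) a2 = edge (n, mask n (f :+: bit n)) a1.
  rewrite -[RHS]edge_add; congr edge; apply/funext => g.
  by rewrite /a2 /sheet_add /leaves /under /= mask_id.
have rs e : wreduced (star l1 e) by exact: wreduced_star.
have [-> _] := walkS alpha n f r; rewrite -/l1.
have [_ ->] := walkS a1 n f (rs (edge (n, mask n f) alpha)).
rewrite edge1 starK //.
have ru : wreduced (unwalk a1 n.+1 f l1) by exact: wreduced_unwalk.
have [-> _] := walkS a1 n (f :+: bit n) ru.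
have [-> _] := walk_mask a1 ru sib; rewrite unwalkK //.
have [_ ->] := walkS a2 n (f :+: bit n) (rs (edge (n, mask n (f :+: bit n)) a1)).
rewrite edge2 starK //.
by have [_ ->] := walk_mask a2 r1 sib.
Qed.

Lemma run_hop n f s : run (hop 0) (zword n f) s = hop n f s.
Proof. by elim: n f s => [|n IH] f s //; rewrite run_cat !IH hopS. Qed.

Lemma hop_klein : klein_action (hop 0).
Proof.
split=> [f s|n f s]; first exact: hopK.
rewrite !run_cat !run_hop -hopS -{2}(lxorK f (bit n)) -hopS.
exact/hop_mask/esym/mask_sibling.
Qed.

Definition origin : position := (exist (@wreduced _) [::] isT, sheet0).

Lemma lift_hop_sheet u : (lift (hop 0) u origin).2 = ab u.
Proof.
elim/klein_ind: u => [|u f IH]; first by rewrite (lift1 hop_klein) ab1.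
rewrite (liftM hop_klein) (lift_kpi hop_klein) /= IH; apply/funext => g.
by rewrite abMz.
Qed.

Definition base_word (u : klein) : seq letter := val (lift (hop 0) u origin).1.

Lemma wreduced_base u : wreduced (base_word u).
Proof. exact: valP. Qed.

Lemma base_word1 : base_word 1 = [::].
Proof. by rewrite /base_word (lift1 hop_klein). Qed.

Lemma base_wordMz u n f : base_word (u * z n f) =
  unwalk (ab (u * z n f)) n f (walk (ab u) n f (base_word u)).
Proof.
rewrite /base_word (liftM hop_klein) (lift_kpi hop_klein) run_hop /= lift_hop_sheet.
by congr unwalk; apply/funext => g; rewrite abMz.
Qed.

(* The kernel of ab acts freely on the Bass-Serre tree, so that the vertex u V_v is
   determined by the reduced path, in the quotient by this kernel, to which the
   geodesic from the base leaf projects; the last edge comes first. *)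
Definition omega (u : klein) (v : node) : seq letter := walk (ab u) v.1 v.2 (base_word u).

Lemma wreduced_omega u v : wreduced (omega u v).
Proof. exact/wreduced_walk/wreduced_base. Qed.

Lemma omega_above u n f :
  omega u (n, f) = star (omega u (n.+1, f)) (edge (n, mask n f) (ab u)).
Proof. by have [] := walkS (ab u) n f (wreduced_base u). Qed.

Lemma omega_above' u n f :
  omega u (n.+1, f) = star (omega u (n, f)) (edge (n, mask n f) (ab u)).
Proof. by rewrite [omega u (n, f)]omega_above starK ?wreduced_omega. Qed.

Lemma omega_mask u n f g : mask n f = mask n g -> omega u (n, f) = omega u (n, g).
Proof. by move=> fg; have [] := walk_mask (ab u) (wreduced_base u) fg. Qed.

Lemma omegaMz u n f : omega (u * z n f) (n, f) = omega u (n, f).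
Proof. by rewrite /omega base_wordMz unwalkK // wreduced_walk // wreduced_base. Qed.

(** * Vertex groups and unique lifting of words *)

Definition vertex_group (v : node) : seq klein :=
  if v.1 is k.+1 then [:: 1; z v.1 v.2; z k v.2; z k (v.2 :+: bit k)]
  else [:: 1; z 0 v.2].

Lemma vertex_groupP k f w : reflect
  (exists i j : bool, w = z k f ^+ i * z k (f :+: bit k) ^+ j)
  (w \in vertex_group (k.+1, f)).
Proof.
rewrite !inE; apply: (iffP or4P) => [|[[] [[] ->]]].
- case=> /eqP ->; [exists false, false|exists true, true|exists true, false|exists false, true];
    by rewrite !expgb ?mul1g ?mulg1 ?zS.
- by apply: Or42; rewrite !expgb zS.
- by apply: Or43; rewrite !expgb mulg1.
- by apply: Or44; rewrite !expgb mul1g.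
- by apply: Or41; rewrite !expgb mulg1.
Qed.

Lemma zX2 n f (i j : bool) : z n f ^+ i * z n f ^+ j = z n f ^+ (i (+) j).
Proof. by case: i; case: j; rewrite !expgb ?mul1g ?mulg1 ?zz. Qed.

Lemma vertex_group1 v : 1 \in vertex_group v.
Proof. by case: v => [[|k] f]; rewrite inE eqxx. Qed.

Lemma vertex_groupM v w w' :
  w \in vertex_group v -> w' \in vertex_group v -> w * w' \in vertex_group v.
Proof.
case: v => [[|k] f].
  rewrite !inE => /orP[]/eqP -> /orP[]/eqP ->;
  by rewrite ?mul1g ?mulg1 ?zz ?eqxx ?orbT.
move=> /vertex_groupP[i [j ->]] /vertex_groupP[i' [j' ->]]; apply/vertex_groupP.
exists (i (+) i'), (j (+) j'); rewrite -!zX2 -!mulgA; congr (_ * _).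
rewrite !mulgA; congr (_ * _).
by apply: commuteX2; rewrite /commute zC.
Qed.

Lemma vertex_groupV v w : w \in vertex_group v -> w^-1 = w.
Proof.
have inv (x : klein) : x * x = 1 -> x^-1 = x.
  by move=> xx; apply: (mulgI x); rewrite mulgV xx.
case: v => [[|k] f].
  by rewrite !inE => /orP[]/eqP ->; rewrite ?invg1 ?zV.
move=> /vertex_groupP[i [j ->]]; apply: inv.
have c : z k f ^+ i * z k (f :+: bit k) ^+ j = z k (f :+: bit k) ^+ j * z k f ^+ i.
  by apply: commuteX2; rewrite /commute zC.
by rewrite {1}c -mulgA (mulgA (z k f ^+ i)) zX2 addbb expg0 mul1g zX2 addbb.
Qed.

(** The indicators of the two children of a node are independent, so [ab] is injective on vertex
    groups: this is the freeness of the action of its kernel. *)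
Lemma ab_vertex_group v w : w \in vertex_group v -> (forall g, ab w g = false) -> w = 1.
Proof.
case: v => [[|k] f].
  rewrite !inE => /orP[]/eqP -> // /(_ f); by rewrite abz under_self.
move=> /vertex_groupP[i [j ->]] ab0.
have abX n h (b : bool) g : ab (z n h ^+ b) g = b && under n h g.
  by case: b; rewrite expgb ?abz ?ab1.
have := ab0 f; rewrite abM !abX under_self under_sibling andbT andbF addbF => ->.
have := ab0 (f :+: bit k); rewrite abM !abX under_self andbT.
have : under k f (f :+: bit k) = false.
  by have := under_sibling k (f :+: bit k); rewrite lxorK.
by move=> ->; rewrite andbF => /= ->; rewrite !expgb mul1g.
Qed.

Definition canonical (v : node) : Prop := mask v.1 v.2 = v.2.

Definition ends (b v v' : node) : Prop :=
  (v = b /\ v' = above b) \/ (v = above b /\ v' = b).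

Lemma endsC b v v' : ends b v v' -> ends b v' v.
Proof. by case=> -[-> ->]; [right|left]. Qed.

Lemma above_neq b : above b <> b.
Proof. by move=> /(congr1 fst) /=; lia. Qed.

Lemma ends_inj b v v1 v2 : ends b v v1 -> ends b v v2 -> v1 = v2.
Proof.
by case=> -[-> ->] [[e ->]|[e ->]] //; case: (@above_neq b).
Qed.

Definition ze (b : node) : klein := z b.1 b.2.

Lemma ze_vertex_group b v v' : canonical b -> ends b v v' -> ze b \in vertex_group v.
Proof.
case: b => n f cb; rewrite /canonical /= in cb.
case=> -[-> _]; last first.
  rewrite /ze /= !inE; apply/or4P; rewrite /above /=.
  have := maskS_cases n f; rewrite cb => -[] ->.
    exact: Or43.
  by apply: Or44; rewrite lxorK.
by case: n {cb} => [|n]; rewrite !inE eqxx ?orbT.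
Qed.

(** Sheets sharing the edge differ by 0 or [leaves b]. Injectivity of [ab] on the vertex group
    leaves only 1 and [ze b], which belong to the groups of both ends. *)
Lemma vertex_group_edge b v v' u u' : canonical b -> ends b v v' ->
  edge b (ab u) = edge b (ab u') -> u^-1 * u' \in vertex_group v ->
  u^-1 * u' \in vertex_group v'.
Proof.
move=> cb vv' /edge_inj[_ e] uu'.
have zv := ze_vertex_group cb vv'; have zv' := ze_vertex_group cb (endsC vv').
case: e => e.
  rewrite (ab_vertex_group uu') ?vertex_group1 // => g.
  by rewrite abM abV e addbb.
suff -> : u^-1 * u' = ze b by [].
apply: (mulIg (ze b)); rewrite [RHS]zz.
apply: ab_vertex_group (vertex_groupM uu' zv) _ => g.
by rewrite abM abM abV e /sheet_add /ze abz /leaves addbA addbb addFb addbb.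
Qed.

(* The edge path l leads from the base leaf to u V_v. *)
Fixpoint track (l : seq letter) (v : node) (u : klein) : Prop :=
  if l is e :: l' then exists v' u',
    [/\ track l' v' u', canonical e.1, ends e.1 v' v, e = edge e.1 (ab u')
      & u'^-1 * u \in vertex_group v]
  else v = (0, fset0) /\ u \in vertex_group v.

Lemma track_canonical l v u : track l v u -> canonical v.
Proof.
case: l => [[-> _]|e l [v' [u' [_ cb ev _ _]]]]; first by rewrite /canonical mask0.
by case: ev => -[_ ->] //; rewrite /canonical /above /= mask_id.
Qed.

Lemma track_mul l v u w : track l v u -> w \in vertex_group v -> track l v (u * w).
Proof.
case: l => [[-> uV] wV|e l [v' [u' [t cb ev ee uV]]] wV].
  by split=> //; apply: vertex_groupM.
by exists v', u'; split=> //; rewrite mulgA; apply: vertex_groupM.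
Qed.

(** Lifts are unique letter by letter, by [vertex_group_edge]. Hence a word can stand for the vertex
    to which it leads. *)
Lemma track_uniq l v u v' u' : track l v u -> track l v' u' ->
  v = v' /\ u^-1 * u' \in vertex_group v.
Proof.
elim: l v u v' u' => [|e l IH] v u v' u'.
  move=> [-> uV] [-> uV']; split=> //; rewrite (vertex_groupV uV).
  exact: vertex_groupM.
move=> [v1 [u1 [t1 cb ev1 ee1 uV1]]] [v2 [u2 [t2 _ ev2 ee2 uV2]]].
have [e12 uV12] := IH _ _ _ _ t1 t2; rewrite -e12 in ev2.
have vv' := ends_inj ev1 ev2; split=> //.
have uV12' : u1^-1 * u2 \in vertex_group v.
  by apply: vertex_group_edge ev1 _ uV12 => //; rewrite -ee1.
have -> : u^-1 * u' = (u1^-1 * u)^-1 * ((u1^-1 * u2) * (u2^-1 * u')).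
  by rewrite invgM invgK !mulgA !mulgK.
rewrite (vertex_groupV uV1); apply: vertex_groupM => //.
by apply: vertex_groupM; rewrite // vv'.
Qed.

Lemma track_star l v v' u b : track l v u -> canonical b -> ends b v v' ->
  track (star l (edge b (ab u))) v' u.
Proof.
move=> t cb ev.
have pushed : track (edge b (ab u) :: l) v' u.
  by exists v, u; split=> //; rewrite mulVg vertex_group1.
case: l t pushed => [|e l] //= [v1 [u1 [t1 cb1 ev1 ee1 uV1]]] pushed.
case: eqP => // ee; have be : b = e.1 by rewrite ee.
rewrite -be in ee1 ev1.
have -> : v' = v1 by apply: ends_inj ev (endsC ev1).
have -> : u = u1 * (u1^-1 * u) by rewrite mulVKg.
apply: track_mul t1 _; apply: vertex_group_edge (endsC ev1) _ uV1 => //.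
by rewrite -ee1.
Qed.

Fixpoint leads (v : node) (bs : seq node) (v' : node) : Prop :=
  if bs is b :: bs' then exists v1, [/\ canonical b, ends b v v1 & leads v1 bs' v']
  else v = v'.

Lemma leads_cat v bs bs' v' v'' : leads v bs v' -> leads v' bs' v'' ->
  leads v (bs ++ bs') v''.
Proof.
elim: bs v => [|b bs IH] v /=; first by move=> ->.
by move=> [v1 [cb ev l]] l'; exists v1; split=> //; exact: IH.
Qed.

Lemma leads_rev v bs v' : leads v bs v' -> leads v' (rev bs) v.
Proof.
elim: bs v => [|b bs IH] v /=; first by move=> ->.
move=> [v1 [cb ev /IH l]]; rewrite rev_cons -cats1; apply: leads_cat l _.
by exists v; split=> //; exact: endsC.
Qed.

Lemma leads_up n d f : leads (n, mask n f) [seq (k, mask k f) | k <- iota n d]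
  ((n + d)%N, mask (n + d) f).
Proof.
elim: d n => [|d IH] n /=; first by rewrite addn0.
exists (n.+1, mask n.+1 f); split; first by rewrite /canonical /= mask_id.
  by left; rewrite /above /= maskS.
by have := IH n.+1; rewrite addSnnS.
Qed.

Lemma leads_climb L n f : (n <= L)%N -> mask L f = fset0 ->
  leads (0, fset0) (climb L n f) (n, mask n f).
Proof.
move=> nL fL; rewrite /climb; have mask00 k : mask k fset0 = fset0.
  by apply/fsetP => x; rewrite !lampE.
apply: (@leads_cat _ _ _ (L, fset0)).
  have := leads_up 0 L fset0; rewrite add0n !mask00.
  by congr leads; apply: eq_map => k; rewrite mask00.
by apply: leads_rev; have := leads_up n (L - n) f; rewrite subnKC // fL.
Qed.

Lemma track_stars l v u bs v' : track l v u -> leads v bs v' ->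
  track (stars l [seq edge b (ab u) | b <- bs]) v' u.
Proof.
elim: bs l v => [|b bs IH] l v t /=; first by move=> <-.
by move=> [v1 [cb ev]]; apply: IH; exact: track_star ev.
Qed.

Lemma track_walk l u n f :
  track l (0, fset0) u -> track (walk (ab u) n f l) (n, mask n f) u.
Proof.
move=> t; apply: track_stars t (leads_climb (height_ge n f) _).
exact: mask_height.
Qed.

Lemma track_unwalk l u n f : track l (n, mask n f) u ->
  track (unwalk (ab u) n f l) (0, fset0) u.
Proof.
move=> t; rewrite /unwalk /route -map_rev; apply: track_stars t (leads_rev _).
by apply: leads_climb; [exact: height_ge|exact: mask_height].
Qed.

Lemma track_base u : track (base_word u) (0, fset0) u.
Proof.
elim/klein_ind: u => [|u f IH].
  by rewrite base_word1 /=; split; rewrite ?vertex_group1.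
rewrite base_wordMz; apply: track_unwalk; apply: track_mul; first exact: track_walk.
by rewrite mask0 !inE eqxx orbT.
Qed.

Lemma track_omega u n f : track (omega u (n, f)) (n, mask n f) u.
Proof. exact/track_walk/track_base. Qed.

(** * Truncation of paths *)

Section Excess.
Variable p : pred letter.

(* The number of letters read from the first one outside p on; the first letter of
   the path is the last of the list. *)
Fixpoint excess (l : seq letter) : nat :=
  if l is e :: l' then if (excess l' == 0) && p e then 0 else (excess l').+1 else 0.

(** The excess does not decrease along a path, so this keeps the longest initial part of excess at
    most [k]; raising [k] by one restores at most one letter. *)
Fixpoint trim (k : nat) (l : seq letter) : seq letter :=
  if l is e :: l' then if excess l <= k then l else trim k l' else [::].

Lemma trim_cons k e l : trim k (e :: l) =
  if excess (e :: l) <= k then e :: l else trim k l.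
Proof. by []. Qed.

Lemma excess_le l e : (excess l <= excess (e :: l))%N.
Proof. by rewrite /=; case: ifP => [/andP[/eqP ->]|]. Qed.

Lemma trim_id k l : (excess l <= k)%N -> trim k l = l.
Proof. by case: l => //= e l ->. Qed.

Lemma excess_trim k l : (excess (trim k l) <= k)%N.
Proof. by elim: l => //= e l IH; case: ifP. Qed.

Lemma trim_trim k l : trim k (trim k.+1 l) = trim k l.
Proof.
elim: l => // e l IH; rewrite [trim k.+1 _]trim_cons; case: ifP => // h.
rewrite IH [RHS]trim_cons; case: ifP => // h'.
by rewrite (leq_trans h') in h.
Qed.

Lemma trimS_cases k l :
  trim k.+1 l = trim k l \/ exists e, trim k.+1 l = e :: trim k l.
Proof.
elim: l => [|e l IH]; first by left.
rewrite !trim_cons; case: ifP => h; case: ifP => h' //; first by left.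
  right; exists e; rewrite trim_id //.
  move: h h'; rewrite /=; case: ifP => //= _ h h'; lia.
by case: (ltnP k.+1 (excess (e :: l))) h => //; lia.
Qed.

Lemma excess0 l : (excess l == 0) = all p l.
Proof. by elim: l => //= e l <-; case: (excess l == 0) => //=; case: (p e). Qed.

Lemma trim_suffix k l : exists l', l = l' ++ trim k l.
Proof.
elim: l => [|e l [l' IH]]; first by exists [::].
rewrite trim_cons; case: ifP => _; first by exists [::].
by exists (e :: l'); rewrite /= -IH.
Qed.
End Excess.

Definition in_sheet0 : pred letter := fun e => e.2 == sheet0.

(** By [track_uniq] the node does not depend on the choice, and the element does so only up to its
    vertex group. The default serves words that track nothing. *)
Definition wtag (l : seq letter) : node * klein :=
  xget ((0, fset0), 1) [set vu | track l vu.1 vu.2]%classic.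
Definition wend l := (wtag l).1.
Definition wrep l := (wtag l).2.

Lemma wtagP l v u : track l v u ->
  [/\ wend l = v, track l v (wrep l) & (wrep l)^-1 * u \in vertex_group v].
Proof.
move=> t; have := @xgetPex _ ((0, fset0), 1) [set vu | track l vu.1 vu.2]%classic
  (ex_intro _ (v, u) t) => /= t'.
have [e uV] := track_uniq t' t.
by rewrite /wend /wrep /wtag -e.
Qed.

Definition kids (v : node) : seq node :=
  v :: if v.1 is k.+1 then [:: (k, v.2); (k, v.2 :+: bit k)] else [::].

Definition star_group (l : seq letter) : seq klein :=
  [seq wrep l * w | w <- vertex_group (wend l)].

Lemma size_vertex_group v : (size (vertex_group v) <= 4)%N.
Proof. by case: v => [[|k] f]. Qed.

Lemma size_star_group l : (size (star_group l) <= 4)%N.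
Proof. by rewrite size_map size_vertex_group. Qed.

Lemma mem_star_group l v u : track l v u -> u \in star_group l.
Proof.
move=> /wtagP[e _ uV]; apply/mapP; exists ((wrep l)^-1 * u); first by rewrite e.
by rewrite mulVKg.
Qed.

Definition nexts (l : seq letter) : seq letter :=
  [seq edge b (ab u) | b <- kids (wend l), u <- star_group l].

Lemma kidsP b v v' : canonical b -> ends b v v' -> b \in kids v.
Proof.
case: b => n f; rewrite /canonical /= => cb; case=> -[-> _]; first exact: mem_head.
rewrite /kids /above /= !inE; apply/orP; right.
have := maskS_cases n f; rewrite cb => -[] ->; first by rewrite eqxx.
by rewrite lxorK eqxx orbT.
Qed.

Lemma nextsP e l v u : track (e :: l) v u -> e \in nexts l.
Proof.
move=> [v1 [u1 [t cb ev ee _]]]; apply/allpairsP; exists (e.1, u1); split=> //=.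
  by have [-> _ _] := wtagP t; exact: kidsP ev.
exact: mem_star_group t.
Qed.

(** The constant 14: at most 3 edges of T at a node, in at most 4 sheets through the vertex, besides
    the word itself and the word without its last edge. *)
Definition wnbrs (l : seq letter) : seq (seq letter) :=
  l :: behead l :: [seq e :: l | e <- nexts l].

Lemma size_wnbrs l : (size (wnbrs l) <= 14)%N.
Proof.
rewrite /= size_map size_allpairs !ltnS; apply: (@leq_trans (3 * 4)) => //.
by apply: leq_mul (size_star_group l); case: (wend l) => [[|k] f].
Qed.

Definition tracked (l : seq letter) : Prop := exists v u, track l v u.

Lemma tracked_suffix l l' : tracked (l ++ l') -> tracked l'.
Proof.
elim: l => //= e l IH [v [u [v' [u' [t _ _ _ _]]]]].
by apply: IH; exists v', u'.
Qed.

Lemma tracked_omega u v : tracked (omega u v).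
Proof. by case: v => n f; exists (n, mask n f), u; exact: track_omega. Qed.

Lemma trimS_wnbrs p k l : tracked l -> trim p k.+1 l \in wnbrs (trim p k l).
Proof.
move=> tl; have [->|[e ee]] := trimS_cases p k l; first exact: mem_head.
rewrite ee !inE; apply/orP; right; apply/orP; right; apply: map_f.
have [l' el] := trim_suffix p k.+1 l; rewrite el in tl.
have [v [u]] := tracked_suffix tl; rewrite ee; exact: nextsP.
Qed.

Definition word_adj (l l' : seq letter) : Prop := exists u n f,
  (l = omega u (n, f) /\ l' = omega u (n.+1, f)) \/
  (l' = omega u (n, f) /\ l = omega u (n.+1, f)).

Lemma word_adj_cons l l' : word_adj l l' ->
  (exists e, l' = e :: l) \/ (exists e, l = e :: l').
Proof.
move=> [u [n [f [][-> ->]]]].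
  rewrite omega_above'; set e := edge _ _.
  by case: (star_cases (omega u (n, f)) e) => h; [left|right]; exists e.
rewrite omega_above'; set e := edge _ _.
by case: (star_cases (omega u (n, f)) e) => h; [right|left]; exists e.
Qed.

Lemma word_adj_tracked l l' : word_adj l l' -> tracked l /\ tracked l'.
Proof. by move=> [u [n [f [][-> ->]]]]; split; exact: tracked_omega. Qed.

Lemma word_adj_wnbrs p k l l' : word_adj l l' -> trim p k l' \in wnbrs (trim p k l).
Proof.
move=> adj; have [_ [v [u t']]] := word_adj_tracked adj.
case: (word_adj_cons adj) => -[e ee]; subst.
  rewrite trim_cons; case: ifP => h; last exact: mem_head.
  rewrite (trim_id (leq_trans (excess_le p l e) h)).
  rewrite !inE; apply/orP; right; apply/orP; right; apply: map_f.
  exact: nextsP t'.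
rewrite [X in wnbrs X]trim_cons; case: ifP => h; last exact: mem_head.
by rewrite (trim_id (leq_trans (excess_le p l' e) h)) !inE /= eqxx orbT.
Qed.

Lemma word_adj_wnbrs0 l l' : word_adj l l' -> l' \in wnbrs l.
Proof.
move=> /(word_adj_wnbrs in_sheet0 (maxn (excess in_sheet0 l) (excess in_sheet0 l'))).
by rewrite !trim_id // ?leq_maxl ?leq_maxr.
Qed.

Lemma omega1_base : omega 1 (0, fset0) = [::].
Proof.
have mask00 k : (0 <= k)%N -> mask k fset0 = fset0.
  by move=> _; apply/fsetP => x; rewrite !lampE.
rewrite /omega; have [-> _] := walkE (ab 1) (wreduced_base 1) (leqnn 0) mask00.
by rewrite base_word1.
Qed.

Lemma excess_omega1 v : excess in_sheet0 (omega 1 v) = 0.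
Proof.
apply/eqP; rewrite excess0 /omega /walk base_word1.
have stars_sheet l p : all in_sheet0 l -> all in_sheet0 p -> all in_sheet0 (stars l p).
  elim: p l => //= e p IH l al /andP[pe ap]; apply: IH => //.
  case: l al => [|e' l] //=; first by rewrite pe.
  by case: ifP => _ /andP[pe' al]; rewrite ?al //= pe pe'.
apply: stars_sheet => //; rewrite /route all_map; apply/allP => b _ /=.
by rewrite /in_sheet0 ab1 edge0.
Qed.

(** Inside the base copy of T a reduced path is the geodesic to its end; the recursions of [omega]
    reproduce it letter by letter. *)
Lemma excess0_omega1 l v u : track l v u -> wreduced l -> excess in_sheet0 l = 0 ->
  l = omega 1 v.
Proof.
elim: l v u => [|e l IH] v u; first by move=> [-> _]; rewrite omega1_base.
move=> [v1 [u1 [t cb ev ee _]]] r ex.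
have /= /andP[pe pl] : all in_sheet0 (e :: l) by rewrite -excess0 ex.
have rl : wreduced l by move: r => /= /andP[].
have el := IH _ _ t rl (eqP (etrans (excess0 _ _) pl)).
have e1 : e = edge e.1 (ab 1).
  by rewrite ab1 edge0; case: (e) pe => b s /eqP /= ->.
have := star_cons r; rewrite {1}el {1}e1.
case: (e.1) cb ev => n f; rewrite /canonical /= => cb.
have up : omega 1 (above (n, f)) = omega 1 (n.+1, f) by apply: omega_mask; rewrite mask_id.
have := omega_above 1 n f; have := omega_above' 1 n f; rewrite cb -up.
by move=> h1 h2 [][-> ->]; rewrite -?h1 -?h2.
Qed.

(* The projection to the copy of T through the base leaf. *)
Definition foot (l : seq letter) : node := wend (trim in_sheet0 0 l).

Lemma wend_omega u n f : wend (omega u (n, f)) = (n, mask n f).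
Proof. by have [] := wtagP (track_omega u n f). Qed.

Lemma foot_omega1 n f : foot (omega 1 (n, f)) = (n, mask n f).
Proof. by rewrite /foot trim_id ?excess_omega1 // wend_omega. Qed.

Lemma wreduced_suffix (l l' : seq letter) : wreduced (l ++ l') -> wreduced l'.
Proof. by elim: l => //= e l IH /andP[_]. Qed.

Lemma trim0_foot u v : trim in_sheet0 0 (omega u v) = omega 1 (foot (omega u v)) /\
  canonical (foot (omega u v)).
Proof.
have [l' el] := trim_suffix in_sheet0 0 (omega u v).
have r : wreduced (trim in_sheet0 0 (omega u v)).
  by apply: (@wreduced_suffix l'); rewrite -el wreduced_omega.
have [w [x t]] : tracked (trim in_sheet0 0 (omega u v)).
  by apply: (@tracked_suffix l'); rewrite -el; exact: tracked_omega.
have e0 : excess in_sheet0 (trim in_sheet0 0 (omega u v)) = 0.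
  by apply/eqP; rewrite -leqn0 excess_trim.
have [ew _ _] := wtagP t; rewrite /foot ew.
by split; [exact: excess0_omega1 t r e0|exact: track_canonical t].
Qed.

Lemma foot_above u n f : let v := foot (omega u (n, f)) in
  let v' := foot (omega u (n.+1, f)) in
  v' = v \/ v' = above v.
Proof.
move=> v v'.
have end0 : wend (omega u (n, f)) = (n, mask n f) by rewrite wend_omega.
have end1 : wend (omega u (n.+1, f)) = (n.+1, mask n.+1 f) by rewrite wend_omega.
have ab01 : (n.+1, mask n.+1 f) = above (n, mask n f) by rewrite /above /= maskS.
have adj : word_adj (omega u (n, f)) (omega u (n.+1, f)) by exists u, n, f; left.
case: (word_adj_cons adj) => -[e ee].
  have [h|h] := leqP (excess in_sheet0 (omega u (n.+1, f))) 0.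
    right; rewrite /v /v' /foot (trim_id h).
    rewrite trim_id ?end0 ?end1 //; apply: leq_trans h; rewrite ee; exact: excess_le.
  by left; rewrite /v /v' /foot ee trim_cons leqNgt -ee h.
have [h|h] := leqP (excess in_sheet0 (omega u (n, f))) 0.
  right; rewrite /v /v' /foot (trim_id h).
  rewrite trim_id ?end0 ?end1 //; apply: leq_trans h; rewrite ee; exact: excess_le.
by left; rewrite /v /v' /foot ee trim_cons leqNgt -ee h.
Qed.

(** * Vertices of the ambient graph *)

(* (m, c, l) is a vertex of the Bass-Serre tree of the coset m N_c of Gam / H. *)
Definition vertex := (seq syllable * int * seq letter)%type.

Definition loc (m : seq syllable) (c : int) (v : node) : vertex :=
  ((pop c m).1, c, omega (pop c m).2 v).

(* The copy of T in the coset nearest to the root among the cosets at the hub m. *)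
Definition gate (m : seq syllable) : int := if m is s :: _ then s.1 else 0%R.

Definition valid (y : vertex) : Prop :=
  [/\ reduced y.1.1, top_index y.1.1 != Some y.1.2 & exists u v, y.2 = omega u v].

(** Cosets are ranked by their depth from the root coset of copy 0. All cosets at a hub of length s
    have rank s + 1, except the gate, which has smaller rank. *)
Definition rank (y : vertex) : nat :=
  if (y.1.1 == [::]) && (y.1.2 == 0%R) then 0 else (size y.1.1).+1.

Definition tree_adj (y y' : vertex) : Prop := y'.1 = y.1 /\ word_adj y.2 y'.2.

Definition shift_adj (y y' : vertex) : Prop := exists m i f,
  [/\ reduced m, y = loc m i (0, f) & y' = loc m (i + 1)%R (0, shift 1%R f)].

(** [gen_z] fixes the vertex, [gen_a] moves to the sibling leaf across the common parent, and
    [gen_t] changes the coset. Paths of two tree edges also arise when a step of [gen_t] is folded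
    onto the gate. *)
Definition vertex_adj (y y' : vertex) : Prop :=
  [\/ y = y' \/ tree_adj y y', exists y1, tree_adj y y1 /\ tree_adj y1 y',
      shift_adj y y' | shift_adj y' y].

Lemma word_adj_sym l l' : word_adj l l' -> word_adj l' l.
Proof. by move=> [u [n [f h]]]; exists u, n, f; case: h; [right|left]. Qed.

Lemma tree_adj_sym y y' : tree_adj y y' -> tree_adj y' y.
Proof. by move=> [e /word_adj_sym]. Qed.

Lemma tree_adj_valid y y' : tree_adj y y' -> valid y -> valid y'.
Proof.
move=> [e [u [n [f h]]]] [r t _]; rewrite /valid e; split=> //; exists u.
by case: h => -[h1 h2]; [exists (n.+1, f)|exists (n, f)].
Qed.

Lemma tree_adj_rank y y' : tree_adj y y' -> rank y' = rank y.
Proof. by rewrite /rank => -[->]. Qed.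

(** A vertex knows the element of its coset only up to the vertex group, which leaves at most four
    hubs. *)
Definition hubs (y : vertex) : seq (seq syllable) :=
  [seq push y.1.1 y.1.2 u | u <- star_group y.2].

Lemma hubsP m i v : reduced m -> m \in hubs (loc m i v).
Proof.
move=> r; apply/mapP; exists (pop i m).2; last by rewrite /= push_popE.
by case: v => n f; exact: mem_star_group (track_omega _ _ _).
Qed.

Lemma size_hubs y : (size (hubs y) <= 4)%N.
Proof. by rewrite size_map size_star_group. Qed.

Definition shift_nbrs (y : vertex) : seq vertex :=
  [seq loc m (y.1.2 + 1)%R (0, shift 1%R (wend y.2).2) | m <- hubs y] ++
  [seq loc m (y.1.2 - 1)%R (0, shift (-1)%R (wend y.2).2) | m <- hubs y].

Lemma shift_nbrsP y y' : shift_adj y y' \/ shift_adj y' y -> y' \in shift_nbrs y.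
Proof.
have e m i f : (wend (loc m i (0, f)).2).2 = f by rewrite wend_omega /= mask0.
rewrite mem_cat; case=> -[m [i [f [r ey ey']]]]; apply/orP; [left|right]; subst.
  by apply/mapP; exists m; [exact: hubsP|rewrite e].
apply/mapP; exists m; first exact: hubsP.
by rewrite e /= GRing.addrK shiftD GRing.addNr shift0.
Qed.

Lemma size_shift_nbrs y : (size (shift_nbrs y) <= 8)%N.
Proof. by rewrite size_cat !(size_map _ (hubs y)) addnn (leq_double _ 4) size_hubs. Qed.

Section Neighbours.
Variables (k : nat) (L : eqType) (phi : vertex -> L).

Definition tree_bounded : Prop := exists nb : L -> seq L,
  (forall l, size (nb l) <= 14)%N /\
  forall y y', valid y -> rank y <= k -> tree_adj y y' -> phi y' \in nb (phi y).

(** The number 28 is dictated by the quotients [stage]: 4 labels in the gate, and 4 + 4 for each of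
    3 copies. *)
Definition shift_bounded : Prop := exists nb : L -> seq L,
  (forall l, size (nb l) <= 28)%N /\
  forall y y', valid y -> valid y' -> rank y <= k -> rank y' <= k ->
    shift_adj y y' \/ shift_adj y' y -> phi y' \in nb (phi y).

Variables (A : finType) (K : sgraph A) (y : A -> vertex).
Hypotheses (y_valid : forall a, valid (y a)) (y_rank : forall a, rank (y a) <= k).
Hypothesis y_adj : forall a b, K a b -> vertex_adj (y a) (y b).

Lemma quotient_degree_nbrs (M : eqType) (f : A -> M) (nb : M -> seq M) d :
  (forall l, size (nb l) <= d) -> (forall a b, K a b -> f b \in nb (f a)) ->
  quotient_degree K d f.
Proof.
move=> sz nbP a; pose rep l := [pick b | f b == l].
exists (pmap rep (nb (f a))); split.
  by apply: leq_trans (sz (f a)); rewrite size_pmap count_size.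
move=> a' b ea /nbP; rewrite ea => bin.
have : rep (f b) by rewrite /rep; case: pickP => // /(_ b); rewrite eqxx.
case rb: (rep (f b)) => [b'|] // _; exists b'.
  by rewrite mem_pmap; apply/mapP; exists (f b).
by move: rb; rewrite /rep; case: pickP => // x /eqP xb [<-].
Qed.

Lemma bounded_merge_cands (M M' : eqType) (f : A -> M) (g : A -> M')
    (cand : M' -> seq M) c :
  (forall a b, f a = f b -> g a = g b) -> (forall l, size (cand l) <= c) ->
  (forall a, f a \in cand (g a)) -> bounded_merge c f g.
Proof.
move=> coarse sz cP; split=> // a; pose rep l := [pick b | f b == l].
exists (pmap rep (cand (g a))); split.
  by apply: leq_trans (sz (g a)); rewrite size_pmap count_size.
move=> b eb; have bin := cP b; rewrite eb in bin.
have : rep (f b) by rewrite /rep; case: pickP => // /(_ b); rewrite eqxx.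
case rb: (rep (f b)) => [b'|] // _; exists b'.
  by rewrite mem_pmap; apply/mapP; exists (f b).
by move: rb; rewrite /rep; case: pickP => // x /eqP xb [<-].
Qed.

(** The constant 240 bounds 1 + 14 + 14 * 14 + 28: the class itself, one tree edge, two tree edges,
    and the steps of [gen_t]. *)
Lemma stage_degree : tree_bounded -> shift_bounded ->
  quotient_degree K 240 (phi \o y).
Proof.
move=> [nb [sz nbP]] [nt [szt ntP]].
pose nn l := l :: nb l ++ flatten [seq nb l1 | l1 <- nb l] ++ nt l.
apply: (quotient_degree_nbrs (nb := nn)) => [l|a b /y_adj].
  rewrite /= !size_cat; have : (size (flatten [seq nb l1 | l1 <- nb l]) <= 14 * 14)%N.
    rewrite size_flatten /shape -map_comp.
    apply: leq_trans (leq_mul (sz l) (leqnn 14)).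
    elim: (nb l) => //= l1 s IH; rewrite mulSn; exact: leq_add (sz l1) IH.
  by have := sz l; have := szt l; lia.
rewrite /nn /= inE !mem_cat; case=> [[->|adj]|[y1 [adj adj']]|adj|adj].
- by rewrite eqxx.
- by rewrite (nbP _ _ (y_valid a) (y_rank a) adj) orbT.
- have v1 := tree_adj_valid adj (y_valid a).
  have r1 : rank y1 <= k by rewrite (tree_adj_rank adj).
  suff -> : phi (y b) \in flatten [seq nb l1 | l1 <- nb (phi (y a))] by rewrite !orbT.
  by apply/flatten_mapP; exists (phi y1); [exact: nbP adj|exact: nbP adj'].
- by rewrite (ntP (y a)) ?orbT //; left.
- by rewrite (ntP (y a)) ?orbT //; right.
Qed.
End Neighbours.

Section Chains.
Variables (A : finType) (K : sgraph A) (c d : nat) (L : Type) (phi : nat -> A -> L).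

Lemma collapsible_descend n :
  (forall s, s < n -> quotient_degree K d (phi s.+1)) ->
  (forall s, s < n -> bounded_merge c (phi s.+1) (phi s)) ->
  collapsible K c d (phi 0) -> collapsible K c d (phi n).
Proof.
elim: n => // n IH deg merge c0; apply: CollapseStep (deg n _) (merge n _) _ => //.
by apply: IH => // s sn; [apply: deg|apply: merge]; exact: ltnW.
Qed.

Lemma collapsible_ascend n :
  (forall s, s < n -> quotient_degree K d (phi s)) ->
  (forall s, s < n -> bounded_merge c (phi s) (phi s.+1)) ->
  collapsible K c d (phi n) -> collapsible K c d (phi 0).
Proof.
elim: n => // n IH deg merge cn; apply: IH => [s sn|s sn|].
- exact/deg/ltnW.
- exact/merge/ltnW.
- exact: CollapseStep (deg n _) (merge n _) cn.
Qed.
End Chains.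

Section Trimming.
Variables (p : pred letter) (k : nat).

Definition trim_at (s : nat) (y : vertex) : vertex :=
  if rank y == k then (y.1, trim p s y.2) else y.

Definition tree_nbrs (y : vertex) : seq vertex := [seq (y.1, l) | l <- wnbrs y.2].

Lemma size_tree_nbrs y : (size (tree_nbrs y) <= 14)%N.
Proof. by rewrite size_map size_wnbrs. Qed.

Lemma tree_nbrsP y y' : tree_adj y y' -> y' \in tree_nbrs y.
Proof.
case: y y' => [mc l] [mc' l'] [/= -> adj]; apply: map_f; exact: word_adj_wnbrs0.
Qed.

Lemma trim_tree_nbrsP s y y' : tree_adj y y' -> trim_at s y' \in tree_nbrs (trim_at s y).
Proof.
move=> adj; rewrite /trim_at (tree_adj_rank adj).
case: ifP => _; last exact: tree_nbrsP.
by case: adj => -> adj; apply: map_f; exact: word_adj_wnbrs.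
Qed.

Lemma trim_tree_bounded j s : tree_bounded j (trim_at s).
Proof.
exists tree_nbrs; split; first exact: size_tree_nbrs.
by move=> y y' _ _; exact: trim_tree_nbrsP.
Qed.

Lemma trim_at_coarse s y y' : trim_at s.+1 y = trim_at s.+1 y' ->
  trim_at s y = trim_at s y'.
Proof.
have rankE t x : rank (trim_at t x) = rank x.
  by rewrite /trim_at; case: ifP => // _; rewrite /rank.
have trimE x : trim_at s x = trim_at s (trim_at s.+1 x).
  rewrite {1 2}/trim_at rankE; case: ifP => rx; rewrite /trim_at rx //=.
  by rewrite trim_trim.
by move=> e; rewrite trimE e -trimE.
Qed.

Lemma trim_at_cand s y : valid y -> trim_at s.+1 y \in tree_nbrs (trim_at s y).
Proof.
move=> [_ _ [u [v e]]]; rewrite /trim_at; case: ifP => _.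
  by apply: map_f; apply: trimS_wnbrs; rewrite e; exact: tracked_omega.
by apply/mapP; exists y.2; rewrite ?mem_head //; case: (y).
Qed.
End Trimming.

Lemma pop_top c m : top_index m != Some c -> pop c m = (m, 1).
Proof. by move=> t; rewrite -{1}[m](push1 _ c) pop_push. Qed.

Lemma rank_loc_off m c v : reduced m -> c != gate m -> rank (loc m c v) = (size m).+1 /\
  loc m c v = (m, c, omega 1 v).
Proof.
move=> r cg; have t : top_index m != Some c.
  by case: m cg {r} => // s m /= cg; rewrite /top_index /= (inj_eq Some_inj) eq_sym.
rewrite /rank /loc pop_top //=; split=> //.
by case: m cg {r t} => //= /negbTE ->.
Qed.

Lemma rank_loc_gate m v : reduced m -> rank (loc m (gate m) v) < (size m).+1.
Proof.
case: m => [|s m] r; rewrite /rank /loc //=.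
by rewrite eqxx /=; case: ifP.
Qed.

(** A hub whose gate had the top rank would have its other cosets one rank higher. So in the
    outermost layer the steps of [gen_t] start on the copy of T at the hub, which trimming leaves
    intact. *)
Lemma shift_adj_excess k y y' : rank y <= k -> rank y' <= k ->
  shift_adj y y' \/ shift_adj y' y -> rank y = k -> 0 < k -> excess in_sheet0 y.2 = 0.
Proof.
have key m i i' v v' : reduced m -> i != i' -> rank (loc m i v) <= k ->
    rank (loc m i' v') <= k -> rank (loc m i v) = k ->
    excess in_sheet0 (loc m i v).2 = 0.
  move=> r ii' _ r' rk; have [e|ne] := eqVneq i (gate m).
    have := rank_loc_gate v r; rewrite -e rk => km.
    have [] := @rank_loc_off m i' v' r; first by rewrite -e eq_sym.
    by move=> e'; move: r'; rewrite e'; lia.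
  by have [_ ->] := rank_loc_off v r ne; rewrite excess_omega1.
have ne (i : int) : (i != i + 1)%R by lia.
move=> ry ry' [] [m [i [f [r ey ey']]]] rk _; subst y y'.
  by apply: key ry ry' rk.
by apply: key ry ry' rk; rewrite // eq_sym.
Qed.

Lemma trim_shift_bounded k s : 0 < k -> shift_bounded k (trim_at in_sheet0 k s).
Proof.
move=> k0; exists shift_nbrs; split=> [y|y y' _ _ ry ry' adj].
  exact: leq_trans (size_shift_nbrs y) _.
have fixed x x' : rank x <= k -> rank x' <= k -> shift_adj x x' \/ shift_adj x' x ->
    trim_at in_sheet0 k s x = x.
  move=> rx rx' a; rewrite /trim_at; case: eqP => // rk.
  have e := shift_adj_excess rx rx' a rk k0.
  by rewrite trim_id ?e //; case: (x).
rewrite (fixed y y') // (fixed y' y) //; first exact: shift_nbrsP.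
by case: adj; [right|left].
Qed.

(** * Quotients of a layer *)

Definition agree_off (p q : nat) (f g : lamps) : Prop :=
  forall x, code x != p -> code x != q -> (x \in f) = (x \in g).

Definition vary (f : lamps) (p q : nat) : seq lamps :=
  [:: f; f :+: bit p; f :+: bit q; f :+: bit p :+: bit q].

Lemma agree_off_sym p q f g : agree_off p q f g -> agree_off p q g f.
Proof. by move=> h x xp xq; rewrite h. Qed.

Lemma vary_agree p q f g : agree_off p q f g -> g \in vary f p q.
Proof.
move=> h; pose d x := (x \in f) (+) (x \in g).
have -> : g = f :+: (if d (pos p) then bit p else fset0)
    :+: (if (q != p) && d (pos q) then bit q else fset0).
  apply/fsetP => x; rewrite !lampE.
  have off n b : code x != n -> (x \in (if b then bit n else fset0)) = false.
    by move=> xn; case: b; rewrite !lampE // (negbTE xn).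
  have on n (b : bool) : code x = n -> (x \in (if b then bit n else fset0)) = b.
    by move=> xn; case: b; rewrite !lampE // xn eqxx.
  have [xp|xp] := eqVneq (code x) p; last first.
    rewrite (off p) // addbF; have [xq|xq] := eqVneq (code x) q; last first.
      by rewrite (off q) // addbF h.
    by rewrite (on q) // -xq xp codeK /= /d addKb.
  rewrite (on p) // -xp codeK.
  have [xq|xq] := eqVneq (code x) q; last by rewrite (off q) // addbF /d addKb.
  by rewrite /= in_fset0 addbF /d addKb.
by rewrite /vary !inE; case: (d _); case: (_ && _); rewrite ?lxor0 eqxx ?orbT.
Qed.

Lemma mask_agree_off n n' p f g : n <= n' <= n.+1 ->
  (forall x, code x != p -> (x \in f) = (x \in g)) ->
  agree_off p n (mask n f) (mask n' g).
Proof. by move=> nn h x xp xn; rewrite !lampE h //; congr andb; lia. Qed.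

Definition gap (m : seq syllable) (c : int) : nat := absz (c - gate m)%R.

(* Moving the lamplighter by one step changes codes by at most 2, hence the node of
   level n in the copy c can be compared with the gate above level
   n + 2 |c - gate|. *)
Definition level (y : vertex) : nat := (foot y.2).1 + (gap y.1.1 y.1.2).*2.

(** The foot is read in the coordinates of the gate, in which a step of [gen_t] within the hub does
    not change the configuration. *)
Definition ground (y : vertex) : lamps :=
  shift (gate y.1.1 - y.1.2)%R (foot y.2).2.

Lemma rank_size k y : rank y = k.+1 -> size y.1.1 = k.
Proof. by rewrite /rank; case: ifP => // _ []. Qed.

Lemma tree_adj_foot y y' : tree_adj y y' ->
  [\/ foot y'.2 = foot y.2,
      foot y'.2 = above (foot y.2) /\ canonical (foot y.2)
    | foot y.2 = above (foot y'.2) /\ canonical (foot y'.2)].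
Proof.
have can u v : canonical (foot (omega u v)) by have [] := trim0_foot u v.
move=> [_ [u [n [f [][-> ->]]]]]; case: (foot_above u n f) => ->;
  by [constructor 1|constructor 2|constructor 3].
Qed.

(** Going up one edge loses a single lamp. In the coordinates of the gate it has code at most
    [level y], because [level] includes twice the gap. *)
Lemma ground_above y y' : y'.1 = y.1 -> foot y'.2 = above (foot y.2) ->
  canonical (foot y.2) ->
  [/\ level y' = (level y).+1,
      forall x, code x != code (pos (foot y.2).1 + (gate y.1.1 - y.1.2))%R ->
        (x \in ground y') = (x \in ground y) &
      mask (level y).+1 (ground y') = mask (level y).+1 (ground y)].
Proof.
rewrite /level /ground /gap => -> ->; case: (foot y.2) => n f; rewrite /canonical /= => cf.
split; first by rewrite addSn.
- move=> x; rewrite (can_eq codeK) !lampE => xn.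
  rewrite -{2}cf lampE; congr andb; suff : code (x - (gate y.1.1 - y.1.2))%R != n by lia.
  by apply: contra xn => /eqP <-; rewrite codeK GRing.subrK.
have -> : absz (y.1.2 - gate y.1.1)%R = absz (gate y.1.1 - y.1.2)%R by lia.
by rewrite -addSn mask_shift.
Qed.

Lemma shift_adjE y y' : shift_adj y y' \/ shift_adj y' y -> exists m i i' f,
  [/\ reduced m, absz (i' - i)%R = 1%N, y = loc m i (0, f)
    & y' = loc m i' (0, shift (i' - i)%R f)].
Proof.
case=> -[m [i [f [r ey ey']]]].
  by exists m, i, (i + 1)%R, f; rewrite (_ : i + 1 - i = 1)%R //; lia.
exists m, (i + 1)%R, i, (shift 1%R f); split=> //; first by lia.
rewrite shiftD (_ : _ + 1 = 0)%R ?shift0 //; lia.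
Qed.

Lemma loc_off m i f : reduced m -> i != gate m ->
  [/\ rank (loc m i (0, f)) = (size m).+1, (loc m i (0, f)).1 = (m, i),
      level (loc m i (0, f)) = (gap m i).*2 &
      ground (loc m i (0, f)) = shift (gate m - i)%R f].
Proof.
move=> r ig; have [er e] := rank_loc_off (0, f) r ig; rewrite er e; split=> //.
  by rewrite /level /= foot_omega1.
by rewrite /ground /= foot_omega1 mask0.
Qed.

Lemma shift_rank k y y' : rank y <= k.+1 -> rank y' <= k.+1 ->
  shift_adj y y' \/ shift_adj y' y -> rank y = k.+1 -> exists m i i' f,
  [/\ reduced m /\ i != gate m, absz (i' - i)%R = 1%N, y = loc m i (0, f),
      y' = loc m i' (0, shift (i' - i)%R f) & size m = k].
Proof.
move=> ry ry' /shift_adjE[m [i [i' [f [r ii ey ey']]]]] rk.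
have [e|ne] := eqVneq i (gate m); last first.
  exists m, i, i', f; split=> //; have [er _ _ _] := loc_off f r ne.
  by move: rk; rewrite ey er => -[].
have := rank_loc_gate (0, f) r; rewrite -e -ey rk => km.
have [|er _ _ _] := @loc_off m i' (shift (i' - i)%R f) r; first by rewrite -e; lia.
by move: ry'; rewrite ey' er; lia.
Qed.

Lemma valid_loc m i v : reduced m -> valid (loc m i v).
Proof.
move=> r; have [r' t] := reduced_pop i r; split=> //; exists (pop i m).2, v.
by [].
Qed.

Definition label := (vertex + seq syllable * int * nat * lamps)%type.

Section Stage.
Variables (k : nat) (rho : nat -> nat) (kappa : int -> int -> int).
Hypothesis rho_le : forall n, rho n <= n.
Hypothesis rhoS : forall n, rho n <= rho n.+1 <= (rho n).+1.
Hypothesis kappa_near : forall g i j, absz (i - j)%R <= 1 ->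
  absz (kappa g i - kappa g j)%R <= 1.
(** The lamp lost on a tree edge must be located from the label: either the copy is known exactly,
    or all lamps of code below the level are already forgotten and only the one of code [level]
    matters. *)
Hypothesis one_side : (forall g c, kappa g c = c) \/ (forall n, rho n = n).

Definition stage (y : vertex) : label :=
  if rank y == k.+1 then
    inr (y.1.1, kappa (gate y.1.1) y.1.2, level y, mask (rho (level y)) (ground y))
  else inl y.

(** Subtracting twice the gap recovers the level of the foot in its own copy; its lamp is then moved
    to the coordinates of the gate. *)
Let spot (m : seq syllable) (e : int) (n : nat) : nat :=
  code (pos (n - (gap m e).*2) + (gate m - e))%R.

Let stage_above y y' : y'.1 = y.1 -> foot y'.2 = above (foot y.2) ->
  canonical (foot y.2) ->
  agree_off (spot y.1.1 (kappa (gate y.1.1) y.1.2) (level y)) (rho (level y))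
    (mask (rho (level y)) (ground y)) (mask (rho (level y).+1) (ground y')).
Proof.
move=> e1 ef can; have [_ gE mE] := ground_above e1 ef can.
case: one_side => [kE|rE].
  by apply: mask_agree_off (rhoS _) _ => x; rewrite /spot kE /level addnK => /gE.
move=> x _; rewrite !rE => xl; have /fsetP/(_ x) := mE; rewrite !lampE => mx.
have [lx|lx] := ltnP (level y) (code x); last first.
  by rewrite !andbF; apply/negbTE; lia.
by move: mx; rewrite lx !andbT => ->; rewrite (ltnW lx) andbT.
Qed.

Let tree_nb (l : label) : seq label :=
  match l with
  | inl y => [seq inl y' | y' <- tree_nbrs y]
  | inr (m, e, n, f) => inr (m, e, n, f) ::
      [seq inr (m, e, n.+1, g) | g <- vary f (spot m e n) (rho n)] ++
      [seq inr (m, e, n.-1, g) | g <- vary f (spot m e n.-1) (rho n.-1)]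
  end.

Lemma stage_tree_bounded j : tree_bounded j stage.
Proof.
exists tree_nb; split=> [[y|[[[m e] n] f]] //|y y' _ _ adj].
  by rewrite size_map size_tree_nbrs.
rewrite /stage (tree_adj_rank adj); case: ifP => rk; last exact/map_f/tree_nbrsP.
have e1 : y'.1 = y.1 by case: adj.
rewrite /tree_nb in_cons mem_cat; case: (tree_adj_foot adj) => [ef|[ef can]|[ef can]].
- by rewrite /level /ground e1 ef eqxx.
- apply/orP; right; apply/orP; left; have [-> _ _] := ground_above e1 ef can.
  rewrite e1; apply: map_f; apply: vary_agree; exact: stage_above.
- apply/orP; right; apply/orP; right.
  have [-> _ _] := ground_above (esym e1) ef can; rewrite e1.
  apply/map_f/vary_agree/agree_off_sym; rewrite -e1; exact: stage_above.
Qed.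

Let shift_nb (l : label) : seq label :=
  match l with
  | inl y => [seq stage y' | y' <- shift_nbrs y]
  | inr (m, e, n, f) => [seq inl (loc m (gate m) (0, g)) | g <- vary f 0 1] ++
      flatten [seq [seq inr (m, d, n.+2, g) | g <- vary f (rho n) (rho n).+1] ++
                   [seq inr (m, d, n.-2, g) | g <- vary f (rho n.-2) (rho n.-2).+1]
              | d <- [:: e; e + 1; e - 1]%R]
  end.

Let rhoSS n : rho n <= rho n.+2 <= (rho n).+2.
Proof. by have := rhoS n; have := rhoS n.+1; lia. Qed.

Let stage_agree n f :
  agree_off (rho n) (rho n).+1 (mask (rho n) f) (mask (rho n.+2) f).
Proof. by move=> x x0 x1; rewrite !lampE; congr andb; have := rhoSS n; lia. Qed.

(** A step of [gen_t] keeps [ground] and changes the gap by one. The level changes by two, so at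
    most two more lamps are forgotten or recovered. *)
Lemma stage_shift_bounded : shift_bounded k.+1 stage.
Proof.
exists shift_nb; split=> [[y|[[[m e] n] f]] //|y y' _ _ ry ry' adj].
  by rewrite size_map; apply: leq_trans (size_shift_nbrs _) _.
rewrite {2}/stage; case: eqP => rk; last exact/map_f/shift_nbrsP.
have [m [i [i' [f [[r ig] ii ey ey' sm]]]]] := shift_rank ry ry' adj rk.
rewrite ey ey'; have [_ -> -> ->] := loc_off f r ig.
rewrite /shift_nb mem_cat; apply/orP.
have [eg|ig'] := eqVneq i' (gate m); [left|right].
  rewrite /stage eg ltn_eqF; last by rewrite -sm; exact: rank_loc_gate.
  (* Next to the gate the gap is 1 and the level 2, so at most the lamps of codes 0 and 1 have been
     forgotten. *)
  apply: map_f; apply: vary_agree => x x0 x1; rewrite !lampE.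
  suff -> : rho (gap m i).*2 <= code x by rewrite andbT.
  by apply: leq_trans (rho_le _) _; rewrite /gap -eg; lia.
have [rk' e1 el eg] := loc_off (shift (i' - i)%R f) r ig'.
rewrite /stage rk' sm eqxx e1 el eg shiftD.
have -> : (gate m - i' + (i' - i) = gate m - i)%R by lia.
apply/flatten_mapP; exists (kappa (gate m) i').
  have : absz (kappa (gate m) i - kappa (gate m) i')%R <= 1 by apply: kappa_near; lia.
  move: (kappa _ i) (kappa _ i') => a b ab.
  suff: (b = a \/ b = a + 1 \/ b = a - 1)%R.
    by case=> [->|[->|->]]; rewrite !inE eqxx ?orbT.
  by lia.
rewrite mem_cat; apply/orP.
have [h|h] : gap m i' = (gap m i).+1 \/ gap m i = (gap m i').+1.
  by move: ig ig' ii; rewrite /gap; lia.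
- by left; rewrite h doubleS; apply/map_f/vary_agree.
- by right; rewrite h doubleS; apply/map_f/vary_agree/agree_off_sym.
Qed.
End Stage.

(** * Retraction to the gate *)

Lemma loc_mask m c n f g : mask n f = mask n g -> loc m c (n, f) = loc m c (n, g).
Proof. by move=> fg; rewrite /loc (omega_mask _ fg). Qed.

Lemma tree_adj_loc m c n f : tree_adj (loc m c (n, f)) (loc m c (n.+1, f)).
Proof. by split=> //; exists (pop c m).2, n, f; left. Qed.

Lemma vertex_adj_sym y y' : vertex_adj y y' -> vertex_adj y' y.
Proof.
case=> [[->|/tree_adj_sym h]|[y1 [/tree_adj_sym h /tree_adj_sym h']]|h|h].
- by constructor 1; left.
- by constructor 1; right.
- by constructor 2; exists y1.
- by constructor 4.
- by constructor 3.
Qed.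

Section Retract.
Variable k : nat.

Definition retract (y : vertex) : vertex :=
  if rank y == k.+1 then loc y.1.1 (gate y.1.1) (level y, ground y) else y.

Lemma retract_valid y : valid y -> valid (retract y).
Proof.
by move=> v; rewrite /retract; case: ifP => // _; apply: valid_loc; case: v.
Qed.

Lemma retract_rank y : valid y -> rank y <= k.+1 -> rank (retract y) <= k.
Proof.
move=> v ry; rewrite /retract; case: eqP => [/rank_size rk|rk]; last by lia.
by have [r _ _] := v; have := rank_loc_gate (level y, ground y) r; rewrite rk ltnS.
Qed.

Lemma retract_tree y y' : tree_adj y y' ->
  retract y = retract y' \/ tree_adj (retract y) (retract y').
Proof.
move=> adj; rewrite /retract (tree_adj_rank adj); case: ifP => rk; last by right.
have e1 : y'.1 = y.1 by case: adj.
case: (tree_adj_foot adj) => [ef|[ef can]|[ef can]].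
- by left; rewrite /level /ground e1 ef.
- right; have [el _ eg] := ground_above e1 ef can.
  by rewrite e1 el (loc_mask _ _ eg); exact: tree_adj_loc.
- right; have [el _ eg] := ground_above (esym e1) ef can.
  apply: tree_adj_sym; rewrite e1 in el eg *; rewrite el (loc_mask _ _ eg).
  exact: tree_adj_loc.
Qed.

Let retract_hub m i f : reduced m -> size m = k ->
  retract (loc m i (0, f)) = loc m (gate m) ((gap m i).*2, shift (gate m - i)%R f).
Proof.
move=> r sm; have [->|ig] := eqVneq i (gate m).
  rewrite /retract ltn_eqF; last by rewrite -sm; exact: rank_loc_gate.
  by rewrite /gap GRing.subrr shift0.
by have [er e1 el eg] := loc_off f r ig; rewrite /retract er sm eqxx e1 el eg.
Qed.

(** The levels of the two vertices differ by two over the same configuration, so their images are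
    joined by two tree edges. *)
Lemma retract_shift y y' : rank y <= k.+1 -> rank y' <= k.+1 ->
  shift_adj y y' -> vertex_adj (retract y) (retract y').
Proof.
have key x x' : rank x <= k.+1 -> rank x' <= k.+1 -> shift_adj x x' \/ shift_adj x' x ->
    rank x = k.+1 -> vertex_adj (retract x) (retract x').
  move=> rx rx' adj rk.
  have [m [i [i' [f [[r ig] ii ex ex' sm]]]]] := shift_rank rx rx' adj rk.
  rewrite ex ex' !retract_hub // shiftD.
  have -> : (gate m - i' + (i' - i) = gate m - i)%R by lia.
  move: (shift _ _) => g; constructor 2.
  have [h|h] : gap m i' = (gap m i).+1 \/ gap m i = (gap m i').+1.
    by move: ig ii; rewrite /gap; lia.
  - exists (loc m (gate m) ((gap m i).*2.+1, g)); rewrite h doubleS.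
    by split; exact: tree_adj_loc.
  - exists (loc m (gate m) ((gap m i').*2.+1, g)); rewrite h doubleS.
    by split; apply: tree_adj_sym; exact: tree_adj_loc.
move=> ry ry' adj; have [rk|rk] := eqVneq (rank y) k.+1.
  by apply: key => //; left.
have [rk'|rk'] := eqVneq (rank y') k.+1.
  by apply: vertex_adj_sym; apply: key => //; right.
by rewrite /retract (negbTE rk) (negbTE rk'); constructor 3.
Qed.

Lemma retract_adj y y' : rank y <= k.+1 -> rank y' <= k.+1 ->
  vertex_adj y y' -> vertex_adj (retract y) (retract y').
Proof.
move=> ry ry'; case=> [[->|/retract_tree h]|[y1 [/retract_tree h /retract_tree h']]|h|h].
- by constructor 1; left.
- by constructor 1.
- case: h => [->|h]; first by constructor 1.
  by case: h' => [<-|h']; [constructor 1; right|constructor 2; exists (retract y1)].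
- exact: retract_shift.
- by apply: vertex_adj_sym; exact: retract_shift.
Qed.

Lemma retract_cand y : valid y -> rank y = k.+1 ->
  (y.1.1, gate y.1.1, level y, mask (level y) (ground y)) \in
  [seq (m, (retract y).1.2, (wend (retract y).2).1, (wend (retract y).2).2)
  | m <- hubs (retract y)].
Proof.
move=> [r _ _] rk; apply/mapP; exists y.1.1; rewrite /retract rk eqxx.
  exact: hubsP.
by rewrite wend_omega.
Qed.
End Retract.

Definition clamp (s : nat) (g c : int) : int :=
  if (c <= g - s%:Z)%R then (g - s%:Z)%R else
  if (g + s%:Z <= c)%R then (g + s%:Z)%R else c.

Definition erode (k r : nat) : vertex -> label := stage k (minn r) (fun _ c => c).
Definition fold_in (k s : nat) : vertex -> label := stage k id (clamp s).

Section StageDegree.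
Variables (k : nat) (A : finType) (K : sgraph A) (y : A -> vertex).
Hypotheses (y_valid : forall a, valid (y a)) (y_rank : forall a, rank (y a) <= k.+1).
Hypothesis y_adj : forall a b, K a b -> vertex_adj (y a) (y b).

Lemma erode_degree r : quotient_degree K 240 (erode k r \o y).
Proof.
apply: stage_degree y_valid y_rank y_adj _ _.
  by apply: stage_tree_bounded => [n|]; [lia|left].
by apply: stage_shift_bounded => [n|n|]; lia.
Qed.

Lemma fold_in_degree s : quotient_degree K 240 (fold_in k s \o y).
Proof.
apply: stage_degree y_valid y_rank y_adj _ _.
  by apply: stage_tree_bounded => [n|]; [lia|right].
apply: stage_shift_bounded => // [n|g i j ij]; first by lia.
by rewrite /clamp; do ?case: ifP => ?; lia.
Qed.

Lemma erode_merge r : bounded_merge 14 (erode k r \o y) (erode k r.+1 \o y).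
Proof.
pose cand (l : label) : seq label := if l is inr (m, e, n, f) then
  [seq inr (m, e, n, g) | g <- vary f r r] else [:: l].
apply: (bounded_merge_cands (cand := cand)) => [a b|[x|[[[m e] n] f]] //|a] /=.
  rewrite /erode /stage; case: ifP => _; case: ifP => _ // [-> -> -> e].
  have maskr n f : mask (minn r.+1 n) f = mask (minn r.+1 n) (mask (minn r n) f).
    by rewrite mask_mask (maxn_idPl _) //; lia.
  by rewrite maskr e -maskr.
rewrite /erode /stage; case: ifP => _; last exact: mem_head.
apply: map_f; apply: vary_agree => x xr _; rewrite !lampE; congr andb; lia.
Qed.

Lemma fold_in_merge s : bounded_merge 14 (fold_in k s.+1 \o y) (fold_in k s \o y).
Proof.
pose cand (l : label) : seq label := if l is inr (m, e, n, f) then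
  [seq inr (m, d, n, f) | d <- [:: e; e + 1; e - 1]%R] else [:: l].
apply: (bounded_merge_cands (cand := cand)) => [a b|[x|[[[m e] n] f]] //|a] /=.
  rewrite /fold_in /stage; case: ifP => _; case: ifP => _ // [-> e -> ->].
  have clampS g c : clamp s g c = clamp s g (clamp s.+1 g c).
    rewrite [clamp s.+1 g c]/clamp.
    by do ?case: ifP => ?; rewrite /clamp; do ?case: ifP => ?; lia.
  by rewrite clampS e -clampS.
rewrite /fold_in /stage; case: ifP => _; last exact: mem_head.
apply: (map_f (fun d => inr (_, d, _, _))).
move: (gate _) (y a).1.2 => g c; suff : (clamp s.+1 g c = clamp s g c \/
  clamp s.+1 g c = clamp s g c + 1 \/ clamp s.+1 g c = clamp s g c - 1)%R.
  by case=> [->|[->|->]]; rewrite !inE eqxx ?orbT.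
by rewrite /clamp; do ?case: ifP => ?; lia.
Qed.

(** Only a change of coordinates: a trimmed word is the geodesic to its foot, and with [r = 0] no
    lamp is masked. *)
Lemma trim_erode_merge :
  bounded_merge 14 (trim_at in_sheet0 k.+1 0 \o y) (erode k 0 \o y).
Proof.
pose cand (l : label) : seq vertex := match l with
  | inl x => [:: x]
  | inr (m, e, n, f) =>
      [:: (m, e, omega 1 (n - (gap m e).*2, shift (e - gate m)%R f))]
  end.
apply: (bounded_merge_cands (cand := cand)) => [a b|[x|[[[m e] n] f]] //|a] /=.
  have rankE x : rank (trim_at in_sheet0 k.+1 0 x) = rank x.
    by rewrite /trim_at; case: ifP => // _; rewrite /rank.
  move=> e; have re : rank (y a) = rank (y b) by rewrite -rankE e rankE.
  move: e; rewrite /trim_at /erode /stage re; case: ifP => [_|_ -> //] [e1 e2].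
  by rewrite /level /ground /foot e2 e1.
rewrite /trim_at /erode /stage; case: ifP => rk; last exact: mem_head.
have [_ _ [u [v e]]] := y_valid a; have [et _] := trim0_foot u v.
rewrite inE e et /level /ground addnK min0n mask0 shiftD e.
have -> : ((y a).1.2 - gate (y a).1.1 + (gate (y a).1.1 - (y a).1.2) = 0)%R by lia.
by rewrite shift0; case: (foot _); case: ((y a).1).
Qed.

(** Once every copy is folded onto the gate, a label is a hub with a node. The retracted vertex
    remembers the node and has at most four hubs; the fifth candidate is an untouched vertex. *)
Lemma fold_in_retract_merge :
  bounded_merge 14 (fold_in k 0 \o y) (retract k \o y).
Proof.
have clamp0 g c : clamp 0 g c = g by rewrite /clamp; do ?case: ifP => ?; lia.
pose cand (x : vertex) : seq label := inl x ::
  [seq inr (m, x.1.2, (wend x.2).1, (wend x.2).2) | m <- hubs x].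
apply: (bounded_merge_cands (cand := cand)) => [a b|x|a] /=.
- rewrite /fold_in /stage /retract; case: ifP => _; case: ifP => _ // -[->] //.
    by rewrite !clamp0 => _ -> /(loc_mask _ _) ->.
- by rewrite size_map; have := size_hubs x; lia.
rewrite in_cons; apply/orP; rewrite /fold_in /stage.
have [rk|rk] := eqVneq (rank (y a)) k.+1.
  right; rewrite clamp0; have /mapP[m mh [e1 e2 e3 e4]] := retract_cand (y_valid a) rk.
  by apply/mapP; exists m; rewrite // -e2 -e3 -e4 -e1.
by left; rewrite /retract (negbTE rk).
Qed.
End StageDegree.

(** * Finite twin-width *)

Lemma bounded_on (A : finType) (f : A -> nat) : exists n, forall a, f a <= n.
Proof. by exists (\max_a f a) => a; exact: leq_bigmax. Qed.

Lemma trim_at_merge p k s (A : finType) (y : A -> vertex) :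
  (forall a, valid (y a)) ->
  bounded_merge 14 (trim_at p k s.+1 \o y) (trim_at p k s \o y).
Proof.
move=> v; apply: (bounded_merge_cands (cand := tree_nbrs)) => [a b|x|a] /=.
- exact: trim_at_coarse.
- exact: size_tree_nbrs.
- exact: trim_at_cand.
Qed.

Lemma trim_at_eventually p k (A : finType) (y : A -> vertex) :
  exists n, trim_at p k n \o y = y.
Proof.
have [n nP] := bounded_on (fun a => excess p (y a).2); exists n.
apply/funext => a; rewrite /= /trim_at; case: ifP => // _.
by rewrite trim_id //; case: (y a).
Qed.

Lemma collapsible_vertices k (A : finType) (K : sgraph A) (y : A -> vertex) :
  (forall a, valid (y a)) -> (forall a, rank (y a) <= k) ->
  (forall a b, K a b -> vertex_adj (y a) (y b)) -> collapsible K 14 240 y.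
Proof.
elim: k y => [|k IH] y y_valid y_rank y_adj.
  (* For [pred0] the excess is the length, so the single coset of rank 0 is cut back to its base
     leaf. *)
  have [n yE] := trim_at_eventually pred0 0 y; rewrite -{}yE.
  apply: (collapsible_descend (phi := fun s => trim_at pred0 0 s \o y)) => [s _|s _|].
  - apply: stage_degree y_valid y_rank y_adj (trim_tree_bounded _ _ _ _) _.
    exists (fun=> [::]); split=> // x x' _ _ rx rx'.
    move=> /shift_adjE[m [i [i' [f [_ ii ex ex']]]]].
    move: rx rx'; rewrite ex ex' /rank /=; case: ifP => // /andP[_ /eqP i0].
    by case: ifP => // /andP[_ /eqP i0']; move: ii; rewrite i0 i0'.
  - exact: trim_at_merge.
  apply: CollapseEnd => a b /=.
  have E c : trim_at pred0 0 0 (y c) = ([::], 0%R, [::]).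
    have := y_rank c; rewrite leqn0 /trim_at => r0; rewrite r0.
    have : (excess pred0 (trim pred0 0 (y c).2) == 0) by rewrite -leqn0 excess_trim.
    rewrite excess0; case: (trim _ _ _) => // _.
    move: r0; rewrite /rank; case: (y c) => -[m i] l /=.
    by case: ifP => // /andP[/eqP -> /eqP ->].
  by rewrite !E.
have [n yE] := trim_at_eventually in_sheet0 k.+1 y; rewrite -{}yE.
apply: (collapsible_descend (phi := fun s => trim_at in_sheet0 k.+1 s \o y)) => [s _|s _|].
- apply: stage_degree y_valid y_rank y_adj (trim_tree_bounded _ _ _ _) _.
  exact: trim_shift_bounded.
- exact: trim_at_merge.
apply: CollapseStep _ (trim_erode_merge _ y_valid) _.
  apply: stage_degree y_valid y_rank y_adj (trim_tree_bounded _ _ _ _) _.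
  exact: trim_shift_bounded.
have [R RP] := bounded_on (fun a => level (y a)).
have [S SP] := bounded_on (fun a => gap (y a).1.1 (y a).1.2).
apply: (collapsible_ascend (n := R) (phi := fun r => erode k r \o y)) => [r _|r _|].
- exact: erode_degree.
- exact: erode_merge.
(* [R] exceeds or equals every level and [S] every gap, so both labels mask all lamps below the
   level and keep the true copy. *)
have -> : erode k R \o y = fold_in k S \o y.
  apply/funext => a /=; rewrite /erode /fold_in /stage (minn_idPr (RP a)).
  rewrite (_ : clamp S _ _ = (y a).1.2) //; have := SP a; rewrite /gap /clamp.
  by do ?case: ifP => ?; lia.
apply: (collapsible_descend (phi := fun s => fold_in k s \o y)) => [s _|s _|].
- exact: fold_in_degree.
- exact: fold_in_merge.
apply: CollapseStep _ (fold_in_retract_merge _ y_valid) _.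
  exact: fold_in_degree.
apply: IH => [a|a|a b ab] /=.
- exact: retract_valid.
- exact: retract_rank.
- by apply: retract_adj => //; exact: y_adj.
Qed.

Definition place (x : Gam) : vertex := loc (val x.1) x.2.1 (0, x.2.2).

Lemma place_adj (x x' : Gam) : Cay gens x x' -> vertex_adj (place x) (place x').
Proof.
have key s x1 : s \in gens -> vertex_adj (place x1) (place (x1 * s)).
  rewrite !inE -orbA => /or3P[]/eqP ->.
  - constructor 3; rewrite mul_t; exists (val x1.1), x1.2.1, x1.2.2.
    by split=> //; exact: valP.
  - constructor 2; exists (loc (val x1.1) x1.2.1 (1%N, x1.2.2)); rewrite mul_a /place.
    split; first exact: tree_adj_loc.
    rewrite /= -(@loc_mask _ _ 1%N (x1.2.2 :+: bit 0)) ?mask_sibling //.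
    by apply: tree_adj_sym; exact: tree_adj_loc.
  - constructor 1; left; rewrite /place.
    have -> : val (x1 * gen_z).1 = append (val x1.1) x1.2.1 (z 0 x1.2.2).
      by rewrite mul_z -mul_single.
    have -> : (x1 * gen_z).2 = x1.2 by rewrite mul_z.
    rewrite /loc /append.
    have [r t] := reduced_pop x1.2.1 (valP x1.1).
    by rewrite pop_push //= omegaMz.
move=> /andP[_ /existsP[s /orP[]/eqP ->]]; first exact: key (valP s).
by apply: vertex_adj_sym; exact: key (valP s).
Qed.

Definition coords (x : Gam) : seq syllable * lamplighter := (val x.1, x.2).

Definition coords_nbrs (l : seq syllable * lamplighter) :
    seq (seq syllable * lamplighter) :=
  [:: l; (append l.1 l.2.1 (z 0 l.2.2), l.2);
      (l.1, (l.2.1, l.2.2 :+: bit 0));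
      (l.1, ((l.2.1 + 1)%R, shift 1%R l.2.2));
      (l.1, ((l.2.1 - 1)%R, shift (-1)%R l.2.2))].

Lemma coords_adj (x x' : Gam) : Cay gens x x' -> coords x' \in coords_nbrs (coords x).
Proof.
have coords_t x1 : coords (x1 * gen_t) \in coords_nbrs (coords x1).
  by rewrite mul_t !inE eqxx !orbT.
have coords_a x1 : coords (x1 * gen_a) \in coords_nbrs (coords x1).
  by rewrite mul_a !inE eqxx !orbT.
have coords_z x1 : coords (x1 * gen_z) \in coords_nbrs (coords x1).
  by rewrite mul_z /coords mul_single !inE eqxx !orbT.
have aK (x1 : Gam) : x1 * gen_a * gen_a = x1.
  by rewrite !mul_a /= lxorK; case: x1 => m [i f].
have zK (x1 : Gam) : x1 * gen_z * gen_z = x1.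
  by rewrite !mul_z /= -mulgA -singleM zz single1 mulg1; case: x1.
move=> /andP[_ /existsP[[s sg] /=]].
have : [|| s == gen_t, s == gen_a | s == gen_z] by move: sg; rewrite !inE -orbA.
move=> /or3P[]/eqP -> /orP[]/eqP ->.
- exact: coords_t.
- rewrite mul_t /coords_nbrs /= GRing.addrK (shiftD (-1)%R) GRing.addNr shift0.
  by case: x' => m [i f]; rewrite !inE eqxx !orbT.
- exact: coords_a.
- by rewrite -{1}[x']aK; exact: coords_a.
- exact: coords_z.
- by rewrite -{1}[x']zK; exact: coords_z.
Qed.

Lemma coords_inj : injective coords.
Proof. by move=> [m h] [m' h'] [/val_inj -> ->]. Qed.

Lemma Gam_finite_twin_width : finite_twin_width (Cay gens).
Proof.
exists (14 * 240)%N => A.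
apply: (@collapsible_twin_width _ _ _ _ _ (coords \o val)); last first.
  exact: inj_comp coords_inj val_inj.
pose cand (v : vertex) : seq (seq syllable * lamplighter) :=
  [seq (m, (v.1.2, (wend v.2).2)) | m <- hubs v].
(* Passing from an element to its leaf forgets only which of at most four hubs it belongs to. *)
apply: (@CollapseStep _ _ _ _ _ _ _ (place \o val)).
- by apply: (quotient_degree_nbrs (nb := coords_nbrs)) => // a b /coords_adj.
- apply: (bounded_merge_cands (cand := cand)) => [a b /coords_inj ab|v|a].
  + exact: congr1 ab.
  + by rewrite size_map; apply: leq_trans (size_hubs v) _.
  apply/mapP; exists (val (val a).1); first by apply: hubsP; exact: valP.
  by rewrite /coords /place wend_omega /= mask0; case: (val a).2.
have [k kP] := bounded_on (fun a : A => rank (place (val a))).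
apply: (collapsible_vertices _ kP) => [a|a b]; last exact: place_adj.
by apply: valid_loc; exact: valP.
Qed.

Theorem theorem1 :
  exists Gamma : groupType,
    [/\ finitely_generated Gamma,
        group_finite_twin_width Gamma
      & ~ group_accessible Gamma].
Proof.
exists Gam; split; last exact: Gam_not_accessible.
  by exists gens; exact: generates_gens.
by exists gens; [exact: generates_gens|exact: Gam_finite_twin_width].
Qed.
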